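(* Every representable oriented matroid is HK.
   Context: Oriented matroids are given as $M=(E,\mathcal L)$ with $E$ a finite ground set and $\mathcal L\subseteq\{+,0,-\}^E$ the set of covectors (including $\mathbf 0$); $r(M)$ is the rank. $M$ of rank $r$ is representable if it is realized by an arrangement of linear spheres, i.e. there are vectors $v_e\in\mathbb R^{r}$ ($e\in E$) with $\mathcal L=\{(\mathrm{sign}\langle v_e,x\rangle)_{e\in E}:x\in\mathbb R^{r}\}$. Oriented matroid program. This is a triple $\pi=(M,g,f)$ with $M=(E,\mathcal L)$ an oriented matroid, $g\in E$ not a loop, $f\in E$, $f\ne g$, not a coloop. Its feasible region is $P_\pi=\{X\in\mathcal L: X_g=+,\ X_e\in\{+,0\}\text{ for all }e\in E\setminus\{g,f\}\}$. $P_\pi$ is unbounded if it is nonempty and there is a nonzero $X\in\mathcal L$ with $X_g=0$ and $X_e\in\{+,0\}$ for all $e\in E\setminus\{g,f\}$; otherwise it is bounded. $P_\pi$ is full dimensional if it contains a tope of $M$. The graph $G_\pi$. Its vertices are the cocircuits $V$ of $M\setminus f$ (deletion) with $V_g=+$. Two distinct vertices $V^1,V^2$ are joined by an edge if they are the two cocircuits below a common rank-2 covector of $M\setminus f$ (an element of height 2 in the big face lattice), namely $V^1\circ V^2=V^2\circ V^1$. For such an edge, let $Z$ be the unique cocircuit of $M\setminus f$ obtained by eliminating $g$ from $-V^1$ and $V^2$: $Z_g=0$, $Z^+\subseteq (V^1)^-\cup (V^2)^+$, $Z^-\subseteq (V^1)^+\cup (V^2)^-$. Let $\sigma(Z)\in\{+,0,-\}$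 be the unique sign such that extending $Z$ by $Z_f=\sigma(Z)$ gives a cocircuit of $M$. The edge is oriented from $V^1$ to $V^2$ if $\sigma(Z)=+$, from $V^2$ to $V^1$ if $\sigma(Z)=-$, and is non-oriented if $\sigma(Z)=0$ (so edges are oriented from the negative side of $f$ toward the positive side). $G_\pi^+$ is the subgraph of $G_\pi$ induced on the vertices $V$ with $V_e\in\{+,0\}$ for all $e\in E\setminus\{g,f\}$. The objective $f$ is generic in $P_\pi$ if $G_\pi^+$ has no non-oriented edge. $\pi$ is proper if $P_\pi$ is bounded and full dimensional and $f$ is generic in $P_\pi$. (For proper $\pi$, $G_\pi^+$ has a unique source and a unique sink.) Holt-Klee condition in dimension $d$: a digraph with a unique source and a unique sink satisfies it if there are $d$ directed paths from the source to the sink that are pairwise internally vertex-disjoint. A proper program $\pi=(M,g,f)$ is HK if $G_\pi^+$ satisfies the Holt-Klee condition in dimension $d=r(M)-1$. An oriented matroid $M$ is HK if for every oriented matroid $N=(E_N,\mathcal L_N)$ obtained from $M$ by reorientation and taking minors (including $M$ itself) and any two distinct $f,g\in E_N$ for which $(N,g,f)$ is a proper oriented matroid program, $(N,g,f)$ is HK (with $d=r(N)-1$). *)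

(* Defs.v *)
From HB Require Import structures.
From mathcomp Require Import all_boot all_order all_algebra reals.

Set Implicit Arguments.
Unset Strict Implicit.
Unset Printing Implicit Defensive.

Import Order.TTheory GRing.Theory Num.Theory.

Inductive sign : Set := Neg | Zero | Pos.

Definition sign_encode (a : sign) : option bool :=
  match a with Neg => Some false | Zero => None | Pos => Some true end.

Definition sign_decode (b : option bool) : sign :=
  match b with Some false => Neg | None => Zero | Some true => Pos end.

Lemma sign_encodeK : cancel sign_encode sign_decode.
Proof. by case. Qed.

HB.instance Definition _ := Finite.copy sign (can_type sign_encodeK).

Definition sopp (a : sign) : sign :=
  match a with Neg => Pos | Zero => Zero | Pos => Neg end.

Definition sign_of (R : realType) (x : R) : sign :=
  if (x == 0)%R then Zero else if (0 < x)%R then Pos else Neg.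

Definition nonneg (a : sign) : bool := (a == Pos) || (a == Zero).

Definition svec (T : finType) := {ffun T -> sign}.

Definition szero (T : finType) : svec T := [ffun => Zero].

Definition svopp (T : finType) (X : svec T) : svec T := [ffun e => sopp (X e)].

Definition scomp (T : finType) (X Y : svec T) : svec T :=
  [ffun e => if X e == Zero then Y e else X e].

(* Membership of [e] in the separation set S(X, Y). *)
Definition separates (T : finType) (X Y : svec T) (e : T) : bool :=
  (X e != Zero) && (X e == sopp (Y e)).

(* The componentwise order induced by 0 < + and 0 < -. *)
Definition sle (T : finType) (X Y : svec T) : bool :=
  [forall e, (X e == Zero) || (X e == Y e)].

(* The ground set is a subset of an ambient finite type [T], so that minors stay
   over the same type; covectors are padded with [Zero] outside the ground set.
   The other four fields are the covector axioms. *)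
Record orientedMatroid (T : finType) := OrientedMatroid {
  ground : {set T};
  covectors : {set svec T};
  covector_supp : forall X e, X \in covectors -> e \notin ground -> X e = Zero;
  covector0 : szero T \in covectors;
  covectorN : forall X, X \in covectors -> svopp X \in covectors;
  covector_comp : forall X Y,
    X \in covectors -> Y \in covectors -> scomp X Y \in covectors;
  covector_elim : forall X Y e,
    X \in covectors -> Y \in covectors -> separates X Y e ->
    exists Z, [/\ Z \in covectors, Z e = Zero &
      forall h, ~~ separates X Y h -> Z h = scomp X Y h]
}.

(* The flats of the underlying matroid are the zero sets of the covectors. *)
Definition om_closure (T : finType) (M : orientedMatroid T) (A : {set T}) :
    {set T} :=
  [set e in ground M |
    [forall X in covectors M, [forall a in A, X a == Zero] ==> (X e == Zero)]].

Definition om_indep (T : finType) (M : orientedMatroid T) (A : {set T}) : bool :=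
  (A \subset ground M) && [forall e in A, e \notin om_closure M (A :\ e)].

Definition om_rank (T : finType) (M : orientedMatroid T) : nat :=
  \max_(A : {set T} | om_indep M A) #|A|.

Definition loop (T : finType) (M : orientedMatroid T) (e : T) : bool :=
  e \in om_closure M set0.

Definition coloop (T : finType) (M : orientedMatroid T) (e : T) : bool :=
  (e \in ground M) && (e \notin om_closure M (ground M :\ e)).

Definition cocircuit (T : finType) (M : orientedMatroid T) (X : svec T) : bool :=
  [&& X \in covectors M, X != szero T &
    [forall Y in covectors M, (Y != szero T) && sle Y X ==> (Y == X)]].

Definition tope (T : finType) (M : orientedMatroid T) (X : svec T) : bool :=
  (X \in covectors M) && [forall Y in covectors M, sle X Y ==> (Y == X)].

(* Height in the big face lattice: the greatest length (number of elements minus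
   one) of a chain of covectors below [X]. *)
Definition height (T : finType) (M : orientedMatroid T) (X : svec T) : nat :=
  \max_(C : {set svec T} | [&& C \subset covectors M,
      [forall Y in C, sle Y X] &
      [forall Y in C, [forall Z in C, sle Y Z || sle Z Y]]]) #|C|.-1.

(* The vectors live in dimension [om_rank M], so they necessarily span. *)
Definition representable (R : realType) (T : finType) (M : orientedMatroid T) :
    Prop :=
  exists v : T -> 'rV[R]_(om_rank M), forall X : svec T,
    X \in covectors M <->
    exists x : 'rV[R]_(om_rank M),
      X = [ffun e => if e \in ground M
                     then sign_of (\sum_i v e ord0 i * x ord0 i)%R else Zero].

Section Operations.
Variables (T : finType) (M : orientedMatroid T).
Implicit Types (A : {set T}) (X Y : svec T).

Definition svreorient A X : svec T :=
  [ffun e => if e \in A then sopp (X e) else X e].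

Definition svdelete A X : svec T := [ffun e => if e \in A then Zero else X e].

Let soppK a : sopp (sopp a) = a. Proof. by case: a. Qed.
Let sopp_inj : injective sopp. Proof. exact: (can_inj soppK). Qed.
Let sopp_eq0 a : (sopp a == Zero) = (a == Zero). Proof. by case: a. Qed.

Let reorient_sep A X Y e :
  separates (svreorient A X) (svreorient A Y) e = separates X Y e.
Proof.
rewrite /separates !ffunE; case: (e \in A) => //.
by rewrite sopp_eq0 (inj_eq sopp_inj).
Qed.

Fact reorient_supp A X e :
  X \in svreorient A @: covectors M -> e \notin ground M -> X e = Zero.
Proof.
by case/imsetP=> Y YM -> /(covector_supp YM) Ye; rewrite ffunE Ye if_same.
Qed.

Fact reorient0 A : szero T \in svreorient A @: covectors M.
Proof.
apply/imsetP; exists (szero T); first exact: covector0.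
by apply/ffunP=> e; rewrite !ffunE if_same.
Qed.

Fact reorientN A X : X \in svreorient A @: covectors M ->
  svopp X \in svreorient A @: covectors M.
Proof.
case/imsetP=> Y YM ->; apply/imsetP; exists (svopp Y); first exact: covectorN.
by apply/ffunP=> e; rewrite !ffunE; case: ifP.
Qed.

Let reorient_compE A X Y :
  scomp (svreorient A X) (svreorient A Y) = svreorient A (scomp X Y).
Proof.
apply/ffunP=> e; rewrite !ffunE; case: (e \in A) => //.
by rewrite sopp_eq0; case: ifP.
Qed.

Fact reorient_comp A X Y :
  X \in svreorient A @: covectors M -> Y \in svreorient A @: covectors M ->
  scomp X Y \in svreorient A @: covectors M.
Proof.
case/imsetP=> X' XM -> /imsetP[Y' YM ->]; rewrite reorient_compE.
by apply: imset_f; apply: covector_comp.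
Qed.

Fact reorient_elim A X Y e :
  X \in svreorient A @: covectors M -> Y \in svreorient A @: covectors M ->
  separates X Y e ->
  exists Z, [/\ Z \in svreorient A @: covectors M, Z e = Zero &
    forall h, ~~ separates X Y h -> Z h = scomp X Y h].
Proof.
case/imsetP=> X' XM -> /imsetP[Y' YM ->]; rewrite reorient_sep.
case/(covector_elim XM YM) => Z [ZM Ze ZP].
exists (svreorient A Z); split; first exact: imset_f.
  by rewrite ffunE Ze if_same.
move=> f; rewrite reorient_sep => /ZP Zf.
by rewrite reorient_compE !ffunE Zf !ffunE.
Qed.

Definition reorientation A : orientedMatroid T :=
  OrientedMatroid (@reorient_supp A) (reorient0 A) (@reorientN A)
    (@reorient_comp A) (@reorient_elim A).

Let delete_sep A X Y e : separates (svdelete A X) (svdelete A Y) e =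
  (e \notin A) && separates X Y e.
Proof. by rewrite /separates !ffunE; case: (e \in A). Qed.

Let delete_compE A X Y :
  scomp (svdelete A X) (svdelete A Y) = svdelete A (scomp X Y).
Proof. by apply/ffunP=> e; rewrite !ffunE; case: (e \in A). Qed.

Fact deletion_supp A X e : X \in svdelete A @: covectors M ->
  e \notin ground M :\: A -> X e = Zero.
Proof.
case/imsetP=> Y YM ->; rewrite inE negb_and negbK ffunE.
by case: ifP => //= _ /(covector_supp YM).
Qed.

Fact deletion0 A : szero T \in svdelete A @: covectors M.
Proof.
apply/imsetP; exists (szero T); first exact: covector0.
by apply/ffunP=> e; rewrite !ffunE if_same.
Qed.

Fact deletionN A X : X \in svdelete A @: covectors M ->
  svopp X \in svdelete A @: covectors M.
Proof.
case/imsetP=> Y YM ->; apply/imsetP; exists (svopp Y); first exact: covectorN.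
by apply/ffunP=> e; rewrite !ffunE; case: ifP.
Qed.

Fact deletion_comp A X Y :
  X \in svdelete A @: covectors M -> Y \in svdelete A @: covectors M ->
  scomp X Y \in svdelete A @: covectors M.
Proof.
case/imsetP=> X' XM -> /imsetP[Y' YM ->]; rewrite delete_compE.
by apply: imset_f; apply: covector_comp.
Qed.

Fact deletion_elim A X Y e :
  X \in svdelete A @: covectors M -> Y \in svdelete A @: covectors M ->
  separates X Y e ->
  exists Z, [/\ Z \in svdelete A @: covectors M, Z e = Zero &
    forall h, ~~ separates X Y h -> Z h = scomp X Y h].
Proof.
case/imsetP=> X' XM -> /imsetP[Y' YM ->]; rewrite delete_sep => /andP[_].
case/(covector_elim XM YM) => Z [ZM Ze ZP].
exists (svdelete A Z); split; first exact: imset_f.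
  by rewrite ffunE Ze if_same.
move=> f; rewrite delete_sep negb_and negbK delete_compE !ffunE.
by case: ifP => //= _ /ZP ->; rewrite ffunE.
Qed.

Definition deletion A : orientedMatroid T :=
  OrientedMatroid (@deletion_supp A) (deletion0 A) (@deletionN A)
    (@deletion_comp A) (@deletion_elim A).

Definition contract_covectors A : {set svec T} :=
  [set X in covectors M | [forall a in A, X a == Zero]].

Let contractP A X : reflect (X \in covectors M /\ {in A, forall a, X a = Zero})
  (X \in contract_covectors A).
Proof.
rewrite inE; apply: (iffP andP) => -[XM XA]; split=> //.
  by move=> a aA; apply/eqP; move/forall_inP: XA; apply.
by apply/forall_inP=> a /XA ->.
Qed.

Fact contraction_supp A X e : X \in contract_covectors A ->
  e \notin ground M :\: A -> X e = Zero.
Proof.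
case/contractP=> XM XA; rewrite inE negb_and negbK => /orP[/XA //|].
exact: covector_supp.
Qed.

Fact contraction0 A : szero T \in contract_covectors A.
Proof.
by apply/contractP; split=> [|a _]; [exact: covector0 | rewrite ffunE].
Qed.

Fact contractionN A X : X \in contract_covectors A ->
  svopp X \in contract_covectors A.
Proof.
case/contractP=> XM XA; apply/contractP; split; first exact: covectorN.
by move=> a /XA; rewrite ffunE => ->.
Qed.

Fact contraction_comp A X Y :
  X \in contract_covectors A -> Y \in contract_covectors A ->
  scomp X Y \in contract_covectors A.
Proof.
case/contractP=> XM XA /contractP[YM YA]; apply/contractP.
split; first exact: covector_comp.
by move=> a aA; rewrite ffunE XA ?YA.
Qed.

Fact contraction_elim A X Y e :
  X \in contract_covectors A -> Y \in contract_covectors A ->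
  separates X Y e ->
  exists Z, [/\ Z \in contract_covectors A, Z e = Zero &
    forall h, ~~ separates X Y h -> Z h = scomp X Y h].
Proof.
case/contractP=> XM XA /contractP[YM YA].
case/(covector_elim XM YM) => Z [ZM Ze ZP]; exists Z; split=> //.
apply/contractP; split=> // a aA.
by rewrite ZP ?ffunE /separates XA ?YA.
Qed.

Definition contraction A : orientedMatroid T :=
  OrientedMatroid (@contraction_supp A) (contraction0 A) (@contractionN A)
    (@contraction_comp A) (@contraction_elim A).

End Operations.

Inductive obtained (T : finType) (M : orientedMatroid T) :
    orientedMatroid T -> Prop :=
| obtained_refl : obtained M M
| obtained_reorientation N A : obtained M N -> obtained M (reorientation N A)
| obtained_deletion N A : obtained M N -> obtained M (deletion N A)
| obtained_contraction N A : obtained M N -> obtained M (contraction N A).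

Definition om_program (T : finType) (M : orientedMatroid T) (g f : T) : Prop :=
  [/\ g \in ground M, ~~ loop M g, f \in ground M, f != g & ~~ coloop M f].

Definition nonneg_off (T : finType) (M : orientedMatroid T) (g f : T)
    (X : svec T) : bool :=
  [forall e in ground M :\: [set g; f], nonneg (X e)].

Definition feasible (T : finType) (M : orientedMatroid T) (g f : T) :
    {set svec T} :=
  [set X in covectors M | (X g == Pos) && nonneg_off M g f X].

Definition unbounded (T : finType) (M : orientedMatroid T) (g f : T) : Prop :=
  feasible M g f != set0 /\
  exists X, [/\ X \in covectors M, X != szero T, X g = Zero & nonneg_off M g f X].

Definition full_dimensional (T : finType) (M : orientedMatroid T) (g f : T) :
    Prop :=
  exists2 X, X \in feasible M g f & tope M X.

Definition program_vertices (T : finType) (M : orientedMatroid T) (g f : T) :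
    {set svec T} :=
  [set V | cocircuit (deletion M [set f]) V & V g == Pos].

(* The covector [F] below is necessarily V o W = W o V. *)
Definition program_edge (T : finType) (M : orientedMatroid T) (g f : T)
    (V W : svec T) : bool :=
  [&& V \in program_vertices M g f, W \in program_vertices M g f, V != W &
    [exists F in covectors (deletion M [set f]),
      [&& height (deletion M [set f]) F == 2, sle V F & sle W F]]].

Definition eliminates (T : finType) (M : orientedMatroid T) (g f : T)
    (V W Z : svec T) : bool :=
  [&& cocircuit (deletion M [set f]) Z, Z g == Zero,
    [forall e, (Z e == Pos) ==> ((V e == Neg) || (W e == Pos))] &
    [forall e, (Z e == Neg) ==> ((V e == Pos) || (W e == Neg))]].

Definition extend (T : finType) (f : T) (Z : svec T) (a : sign) : svec T :=
  [ffun e => if e == f then a else Z e].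

(* [edge_sign M g f V W a]: sigma(Z) = a, where Z is the (unique) cocircuit
   eliminating g from -V and W.  Exchanging V and W replaces Z by -Z, hence
   sigma(Z) by its opposite, so [program_arc] describes all oriented edges. *)
Definition edge_sign (T : finType) (M : orientedMatroid T) (g f : T)
    (V W : svec T) (a : sign) : bool :=
  [exists Z, eliminates M g f V W Z && cocircuit M (extend f Z a)].

Definition program_arc (T : finType) (M : orientedMatroid T) (g f : T)
    (V W : svec T) : bool :=
  program_edge M g f V W && edge_sign M g f V W Pos.

Definition nonoriented_edge (T : finType) (M : orientedMatroid T) (g f : T)
    (V W : svec T) : bool :=
  program_edge M g f V W && edge_sign M g f V W Zero.

Definition feasible_vertices (T : finType) (M : orientedMatroid T) (g f : T) :
    {set svec T} :=
  [set V in program_vertices M g f | nonneg_off M g f V].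

Definition generic_objective (T : finType) (M : orientedMatroid T) (g f : T) :
    Prop :=
  {in feasible_vertices M g f &, forall V W, ~~ nonoriented_edge M g f V W}.

Definition proper_program (T : finType) (M : orientedMatroid T) (g f : T) :
    Prop :=
  [/\ om_program M g f, ~ unbounded M g f, full_dimensional M g f &
    generic_objective M g f].

(* Below, a digraph is the subgraph of [arc] induced on the vertex set [A]. *)

Definition is_source (V : finType) (A : {set V}) (arc : rel V) (s : V) : bool :=
  (s \in A) && [forall v in A, ~~ arc v s].

Definition is_sink (V : finType) (A : {set V}) (arc : rel V) (t : V) : bool :=
  (t \in A) && [forall v in A, ~~ arc t v].

Definition directed_path (V : finType) (A : {set V}) (arc : rel V) (s t : V)
    (p : seq V) : bool :=
  [&& all [in A] (s :: p), path arc s p, last s p == t & uniq (s :: p)].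

(* Injectivity of [P] rules out repeating a path without internal vertices,
   which would be internally disjoint from itself. *)
Definition holt_klee (V : finType) (A : {set V}) (arc : rel V) (d : nat) : Prop :=
  exists s t : V,
    [/\ forall v, is_source A arc v <-> v = s,
        forall v, is_sink A arc v <-> v = t &
        exists P : 'I_d -> seq V,
          [/\ injective P,
              forall i, directed_path A arc s t (P i) &
              forall i j v, i != j -> v \in s :: P i -> v \in s :: P j ->
                v = s \/ v = t]].

Definition HK_program (T : finType) (M : orientedMatroid T) (g f : T) : Prop :=
  holt_klee (feasible_vertices M g f) (program_arc M g f) (om_rank M).-1.

Definition HK (T : finType) (M : orientedMatroid T) : Prop :=
  forall N, obtained M N ->
  forall f g, f \in ground N -> g \in ground N -> f != g ->
  proper_program N g f -> HK_program N g f.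

(* Main.v *)
Require Import Defs.
From mathcomp Require Import all_boot all_order all_algebra reals.
From mathcomp Require boolp.
From mathcomp Require Import ring lra.

Set Implicit Arguments.
Unset Strict Implicit.
Unset Printing Implicit Defensive.

Import Order.TTheory GRing.Theory Num.Theory.

(** A realization of [M] is recorded as a linear subspace [W] of R^T whose
    sign vectors are the covectors of [M]. Reorientation, deletion and
    contraction act on such subspaces ([realizes_obtained]), so it is enough
    to treat a proper program [(N, g, f)] with [N] realized by some [W].

    The points of [W] with coordinate 1 at [g] and nonnegative coordinates on
    the constraints form a polytope [P]. Its vertices are the feasible
    vertices of the program ([vertex_feasible], [feasible_vertex]), its edges
    are the edges of the program ([edge_adjacent], [adjacent_edge]), and an
    edge is an arc exactly when the coordinate [f] increases along it
    ([program_arcP]). As [f] is generic, it has a unique minimum [s] and a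
    unique maximum [t] on [P], which are the source and the sink.

    By Menger's theorem it remains to find, for every set [S] of fewer than [d
    = r - 1] vertices other than [s] and [t], a monotone path from [s] to [t]
    that avoids [S]. Some linear form [l] that is not identically zero on [P]
    vanishes on [S] and at [s], because these are at most [r - 1] conditions
    on a combination of [r] independent coordinates ([vanishing_polytope]).
    After a change of sign, [l] is nonnegative at [t], and positive somewhere
    on [P] in case it vanishes at [t]. The vertices that maximize [l + a f]
    for some real number [a] carry a monotone path from [s] to [t], the upper
    boundary of the shadow of [P] under [(f, l)] ([shadow_path]). As this
    boundary is concave, [l] is positive at the inner vertices of the path,
    which therefore lie outside [S] ([avoiding_path]).

    If [s -> t] is itself an arc, no set of vertices separates [s] from [t].
    Then [d - 1] paths are found in the digraph without this arc, letting [l]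
    vanish at [t] as well, which keeps the shadow path off this arc; the arc
    is the last path. *)

(** * Menger's theorem for digraphs *)

Section Menger.
Variable V : finType.
Implicit Types (e : rel V) (A B C S : {set V}) (pi : V -> seq V).

(** Some [e]-path from [A] to [B] avoids [S]. *)
Definition path_avoiding e A B S : Prop :=
  exists a p, [/\ a \in A, path e a p, last a p \in B &
    forall v, v \in a :: p -> v \notin S].

(** Pairwise disjoint simple [e]-paths from [A] to [B]; they are indexed by the
    set [C] of their first vertices, and [c :: pi c] is the path that starts at
    [c]. *)
Definition linkage e A B C pi : Prop :=
  (forall c, c \in C ->
     [/\ c \in A, path e c (pi c), last c (pi c) \in B & uniq (c :: pi c)]) /\
  (forall c c' v, c \in C -> c' \in C ->
     v \in c :: pi c -> v \in c' :: pi c' -> c = c').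

Lemma linkage_shorten e A B C pi :
  (forall c, c \in C -> [/\ c \in A, path e c (pi c) & last c (pi c) \in B]) ->
  (forall c c' v, c \in C -> c' \in C ->
     v \in c :: pi c -> v \in c' :: pi c' -> c = c') ->
  exists pi', linkage e A B C pi'.
Proof.
move=> piP piD; exists (fun c => shorten c (pi c));
  split=> [c cC|c c' v cC c'C].
  by have [cA cp cB] := piP c cC; case/shortenP: cp cB.
have [_ cp _] := piP c cC; have [_ c'p _] := piP c' c'C.
case/shortenP: cp => p1 _ _ s1; case/shortenP: c'p => p2 _ _ s2 v1 v2.
have sub x p q : {subset p <= q} -> v \in x :: p -> v \in x :: q.
  by move=> s; rewrite !inE => /orP[->//|/s->]; rewrite orbT.
by apply: (piD c c' v) => //; [apply: sub s1 v1|apply: sub s2 v2].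
Qed.

(** The part of a path up to its first vertex in [A]. *)
Lemma path_first e A a p : path e a p -> has (mem A) (a :: p) ->
  exists q, [/\ path [rel u v | e u v && (u \notin A)] a q,
    last a q \in A & {subset q <= p}].
Proof.
elim: p a => [|b p IHp] a /=; first by rewrite orbF => _ aA; exists [::].
case/andP=> eab ebp; have [aA _|aA /= Hp] := boolP (a \in A).
  by exists [::].
have [q [qp qA sq]] := IHp b ebp Hp; exists (b :: q).
by split=> //= [|v]; rewrite ?eab ?aA // !inE => /orP[->//|/sq->]; rewrite orbT.
Qed.

(** The part of a path from its last vertex in [A]. *)
Lemma path_last e A a p : path e a p -> has (mem A) (a :: p) ->
  exists b q, [/\ b \in A, path [rel u v | e u v && (v \notin A)] b q,
    last b q = last a p & {subset b :: q <= a :: p}].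
Proof.
elim: p a => [|b p IHp] a.
  by rewrite /= orbF => _ aA; exists a, [::]; split.
rewrite [path _ _ _]/= => /andP[eab ebp].
have [Hp _|Hp] := boolP (has (mem A) (b :: p)); last first.
  rewrite [has _ _]/= -[_ || has _ p]/(has (mem A) (b :: p)) (negPf Hp) orbF.
  move/hasPn in Hp => aA; exists a, (b :: p); split=> //.
  apply/(pathP b) => i ltip /=.
  have /pathP -> // : path e a (b :: p) by rewrite /= eab.
  by apply/Hp/mem_nth.
have [c [q [cA qp lq sq]]] := IHp b ebp Hp; exists c, q; split=> // v /sq vp.
by rewrite in_cons vp orbT.
Qed.

(** Menger's theorem for set-to-set paths, following Goering: an arc [x -> y]
    is removed. If the number of disjoint paths must drop, some [S] with fewer
    than [k] vertices separates [A] from [B] in the smaller digraph, and both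
    [x |: S] and [y |: S] are separators of size [k] in the given one. By
    induction there are [k] disjoint paths from [A] to [x |: S] and from [y |:
    S] to [B]; they are glued at the vertices of [S] and along the arc. *)
Theorem menger e A B k :
  (forall S, #|S| < k -> path_avoiding e A B S) ->
  exists C pi, k <= #|C| /\ linkage e A B C pi.
Proof.
have [n] := ubnP #|[set uv : V * V | e uv.1 uv.2]|.
elim: n e A B => // n IHn e A B le_e_n Hk.
have [[x y] /= exy|no_arc] := pickP [pred uv : V * V | e uv.1 uv.2]; last first.
  exists (A :&: B), (fun=> [::]); split.
    rewrite leqNgt; apply/negP=> /Hk[a [[|b p] [aA ap pB pS]]].
      by have:= pS a; rewrite !inE eqxx aA pB => /(_ isT).
    by case/andP: ap => eab; have:= no_arc (a, b); rewrite /= eab.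
  split=> [c|c c' v]; first by rewrite inE => /andP[].
  by rewrite !mem_seq1 => _ _ /eqP<- /eqP<-.
pose e' := [rel u v | e u v && ((u, v) != (x, y))].
have sub_e' : subrel e' e by move=> u v /andP[].
have {IHn} IH A' B' : (forall S, #|S| < k -> path_avoiding e' A' B' S) ->
    exists C pi, k <= #|C| /\ linkage e' A' B' C pi.
  apply: IHn; rewrite ltnS in le_e_n; apply: leq_trans le_e_n.
  apply: proper_card.
  apply/properP; split; first by apply/subsetP=> -[u v];
    rewrite !inE => /andP[].
  by exists (x, y); rewrite !inE //= eqxx andbF.
have [H'|] := boolp.pselect (forall S, #|S| < k -> path_avoiding e' A B S).
  have [C [pi [kC [piP piD]]]] := IH A B H'; exists C, pi; split=> //.
  by split=> // c /piP[? /(sub_path sub_e')].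
case/boolp.existsNP=> S /boolp.not_implyP[ltSk sepS].
pose P := x |: S; pose Q := y |: S.
have uses_xy a p : a \in A -> path e a p -> last a p \in B ->
    (forall v, v \in a :: p -> v \notin S) -> (x \in a :: p) && (y \in a :: p).
  move=> aA ap pB pS; apply/negPn/negP=> xy; case: sepS; exists a, p.
  split=> //; apply/(pathP x) => i ltip; rewrite /= (pathP _ ap) //=.
  apply: contra xy => /eqP[xE yE].
  rewrite -{1}xE -yE mem_nth ?(ltnW ltip) //= ?inE ?mem_nth ?orbT //=.
  by rewrite ltnS ltnW.
have meets (W : {set V}) a p : a \in A -> path e a p -> last a p \in B ->
    S \subset W -> (x \in W) || (y \in W) -> has (mem W) (a :: p).
  move=> aA ap pB /subsetP sSW xyW; apply: contraT => /hasPn pW.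
  have /andP[xp yp] : (x \in a :: p) && (y \in a :: p).
    by apply: uses_xy => // v /pW; apply: contra => /sSW.
  by case/orP: xyW => [/(negP (pW x xp))|/(negP (pW y yp))].
have [C1 [pi1 [kC1 [pi1P pi1D]]]] :
    exists C pi, k <= #|C| /\ linkage e' A P C pi.
  apply: IH => X /Hk[a [p [aA ap pB pX]]].
  have [||q [aq qP sq]] := @path_first e P a p => //.
    by apply: meets => //; [exact: subsetUr|rewrite setU11].
  exists a, q; split=> // [|v]; last first.
    by rewrite inE => /orP[/eqP->|/sq vp]; apply: pX;
      rewrite inE ?eqxx ?vp ?orbT.
  apply: sub_path aq => u v /= /andP[-> uP] /=.
  by apply: contra uP => /eqP[-> _]; rewrite setU11.
have [C2 [pi2 [kC2 [pi2P pi2D]]]] :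
    exists C pi, k <= #|C| /\ linkage e' Q B C pi.
  apply: IH => X /Hk[a [p [aA ap pB pX]]].
  have [||b [q [bQ bq lq sq]]] := @path_last e Q a p => //.
    by apply: meets => //; [exact: subsetUr|rewrite setU11 orbT].
  exists b, q; split=> //; [|by rewrite lq|by move=> v /sq/pX].
  apply: sub_path bq => u v /= /andP[-> vQ] /=.
  by apply: contra vQ => /eqP[_ ->]; rewrite setU11.
pose end1 c := last c (pi1 c).
have cardP : #|P| <= k by rewrite cardsU1; case: (x \in S) => //; apply: ltnW.
have cardQ : #|Q| <= k by rewrite cardsU1; case: (y \in S) => //; apply: ltnW.
have end1_inj : {in C1 &, injective end1}.
  move=> c c' cC c'C eqc; apply: (pi1D c c' (end1 c)) => //; last rewrite eqc.
    exact: mem_last.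
  exact: mem_last.
(* As [P] has at most [k] elements, each of them ends one of the paths. *)
have PE : [set end1 c | c in C1] = P.
  apply/eqP; rewrite eqEcard card_in_imset //.
  rewrite (leq_trans cardP kC1) andbT; apply/subsetP=> _ /imsetP[c cC ->].
  by have [] := pi1P c cC.
have C2E : C2 = Q.
  apply/eqP; rewrite eqEcard (leq_trans cardQ kC2) andbT.
  by apply/subsetP=> c /pi2P[].
(* Otherwise [P], respectively [Q], would be [S], which is too small. *)
have xS : x \notin S.
  apply: contraL (ltSk) => xS; rewrite -leqNgt (leq_trans kC1) //.
  by rewrite -(card_in_imset end1_inj) PE /P (setUidPr _) ?sub1set.
have yS : y \notin S.
  apply: contraL (ltSk) => yS; rewrite -leqNgt (leq_trans kC2) //.
  by rewrite C2E /Q (setUidPr _) ?sub1set.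
have S_end c v : c \in C1 -> v \in c :: pi1 c -> v \in S -> v = end1 c.
  move=> cC vc vS; have: v \in P by rewrite inE vS orbT.
  rewrite -PE => /imsetP[c' c'C vE]; rewrite vE; congr end1.
  by apply: (pi1D c' c v) => //; rewrite vE mem_last.
have S_start b v : b \in Q -> v \in b :: pi2 b -> v \in S -> v = b.
  move=> bQ vb vS; have vQ: v \in Q by rewrite inE vS orbT.
  by apply: (pi2D v b v); rewrite ?C2E ?mem_head.
(* A path of the first linkage meets one of the second only in [S]: otherwise
   switching at the common vertex gives a path from [A] to [B] avoiding [S]. *)
have cross c b v : c \in C1 -> b \in Q -> v \in c :: pi1 c ->
    v \in b :: pi2 b -> v \in S.
  move=> cC bQ vc vb; apply/negPn/negP=> vS; case: sepS.
  have [cA cp _ cU] := pi1P c cC.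
  have [|_ bp bB bU] := pi2P b; first by rewrite C2E.
  have Sc := S_end c _ cC; have Sb := S_start b _ bQ.
  rewrite /end1 in Sc.
  case/splitPl: vc cp cU Sc => p1 p2 lp1; rewrite cat_path => /andP[cp1 _].
  rewrite -cat_cons cat_uniq last_cat lp1 => /and3P[_ /hasPn p12 _] Sc.
  case/splitPl: vb bp bB bU Sb => q1 q2 lq1; rewrite cat_path last_cat lq1.
  case/andP=> _ vq2 lq2; rewrite -cat_cons cat_uniq =>
    /and3P[_ /hasPn q12 _] Sb.
  exists c, (p1 ++ q2); rewrite cat_path last_cat cp1 lp1; split=> // u.
  rewrite -cat_cons mem_cat; case/orP=> uS; apply/negP=> uinS.
    have uE : u = last v p2 by apply: Sc => //; rewrite mem_cat uS.
    case: (p2) p12 uE => [|z p2'] p12 uE /=;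
      first by rewrite uE /= (negPf vS) in uinS.
    have: u \notin c :: p1 by apply: p12; rewrite uE /= mem_last.
    by rewrite uS.
  have uE : u = b by apply: Sb => //; rewrite mem_cat uS orbT.
  by have /negP[] := q12 u uS; rewrite uE mem_head.
(* A path that ends at [u] is continued by the one that starts at [s2 u]. *)
pose s2 u := if u == x then y else u.
pose tail2 u := if u == x then y :: pi2 y else pi2 u.
have s2Q u : u \in P -> s2 u \in Q.
  rewrite /s2 !inE; case: (eqVneq u x) => [_|_ /= uS]; first by rewrite eqxx.
  by rewrite uS orbT.
have s2_inj : {in P &, injective s2}.
  move=> u w; rewrite /s2 !inE.
  case: (eqVneq u x) => [->|_] /=; case: (eqVneq w x) => [->|_] //= wS uS wE.
    by rewrite -wE (negPf yS) in uS.
  by rewrite wE (negPf yS) in wS.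
have sub_tail2 u : {subset tail2 u <= s2 u :: pi2 (s2 u)}.
  move=> w; rewrite /tail2 /s2; case: ifP => // _ wu.
  by rewrite in_cons wu orbT.
have end1P c : c \in C1 -> end1 c \in P by move=> cC; rewrite -PE imset_f.
have mixed c c' v : c \in C1 -> c' \in C1 -> v \in c :: pi1 c ->
    v \in tail2 (end1 c') -> c = c'.
  move=> cC c'C v1 /sub_tail2 v2.
  have Q' := s2Q _ (end1P _ c'C).
  have vS := cross _ _ _ cC Q' v1 v2.
  have vE := S_end _ _ cC v1 vS; have vE' := S_start _ _ Q' v2 vS.
  apply: end1_inj => //; rewrite -vE vE' /s2; case: ifP => // xE.
  by rewrite /s2 xE in vE'; rewrite vE' (negPf yS) in vS.
pose tl c := pi1 c ++ tail2 (end1 c).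
suff [pi'] : exists pi', linkage e A B C1 pi' by exists C1, pi'.
apply: (@linkage_shorten _ _ _ _ tl) => [c cC|c c' v cC c'C].
  have [cA cp _ _] := pi1P c cC.
  have [|_ bp bB _] := pi2P (s2 (end1 c)); first by rewrite C2E s2Q ?end1P.
  split=> //; rewrite /tl ?last_cat ?cat_path -/(end1 c); last first.
    by move: bB; rewrite /tail2 /s2; case: ifP.
  rewrite (sub_path sub_e' cp) /=; have {bp} := sub_path sub_e' bp.
  by rewrite /tail2 /s2; case: (eqVneq (end1 c) x) => [->|] //=; rewrite exy.
rewrite /tl -!cat_cons !mem_cat => /orP[v1|v1] /orP[v2|v2].
- exact: pi1D v1 v2.
- exact: mixed v1 v2.
- by apply/esym; apply: mixed v2 v1.
- apply: end1_inj => //; apply: s2_inj; rewrite ?end1P //.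
  by apply: (pi2D _ _ v); rewrite ?C2E ?s2Q ?end1P //; apply: sub_tail2.
Qed.

(** Menger's theorem for internally disjoint paths between two vertices. The
    arc [s -> t] is left out, since no set of vertices can destroy it. *)
Theorem menger_st e s t k : s != t ->
  (forall S, #|S| < k -> s \notin S -> t \notin S ->
     exists p, [/\ path [rel u v | e u v && ((u, v) != (s, t))] s p,
       last s p = t & forall v, v \in p -> v \notin S]) ->
  exists ps : seq (seq V), [/\ size ps = k, uniq ps,
    forall p, p \in ps ->
      [/\ path [rel u v | e u v && ((u, v) != (s, t))] s p, last s p = t &
          uniq (s :: p)] &
    forall p q v, p \in ps -> q \in ps -> p != q ->
      v \in p -> v \in q -> v = t].
Proof.
move=> neq_st Hk; pose inner := [pred v | (v != s) && (v != t)].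
pose A := [set v in inner | e s v]; pose B := [set v in inner | e v t].
pose e' := [rel u v | [&& e u v, inner u & inner v]].
have [S ltSk|C [pi [kC [piP piD]]]] := @menger e' A B k.
  have [|||p] := Hk (S :\: [set s; t]); rewrite ?inE ?eqxx ?orbT //.
    by apply: leq_ltn_trans ltSk; apply/subset_leq_card/subsetDl.
  case=> sp; case/shortenP: sp => p' sp' Up' sp'p lp' pS.
  case/lastP: p' => [|[|a q] b] in sp' Up' sp'p lp' *.
  - by rewrite /= in lp'; rewrite lp' eqxx in neq_st.
  - by move: sp'; rewrite /= in lp' *; rewrite lp' eqxx andbF.
  move: lp' Up' sp'; rewrite last_rcons => ->; rewrite rcons_cons /= => Up'.
  rewrite rcons_path => /andP[/andP[esa _] /andP[aq /andP[et _]]].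
  have inn v : v \in a :: q -> inner v.
    move=> vq; rewrite /=; apply/andP; split; apply: contraTN Up' => /eqP vE.
      by rewrite -rcons_cons mem_rcons inE -vE vq orbT.
    rewrite -[(a \notin _) && _]/(uniq (rcons (a :: q) t)).
    by rewrite rcons_uniq -vE vq andbF.
  exists a, q; split=> [|||v vq]; rewrite ?inE.
  - by rewrite esa andbT; apply/inn/mem_head.
  - apply/(pathP a) => i ltiq; have /andP[eq _] := pathP a aq i ltiq.
    apply/and3P; split=> //; apply: inn; first by rewrite mem_nth //= ltnS ltnW.
    by rewrite in_cons mem_nth ?orbT.
  - by rewrite et andbT; apply/inn/mem_last.
  have vp : v \in p by apply: sp'p; rewrite mem_rcons inE vq orbT.
  have := pS v vp; have /andP[/negPf vs /negPf vt] := inn v vq.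
  by rewrite !inE vs vt.
(* The paths of the linkage run through inner vertices only, so that adding [s]
   and [t] at their ends keeps them simple. *)
have in_pi c v : c \in C -> v \in c :: pi c -> inner v.
  case/piP=> cA cp _ _; rewrite inE => /orP[/eqP->|].
    by move: cA; rewrite inE => /andP[].
  move: (pi c) cp => q cq.
  elim: q c cq {cA} => //= w p IHp c /andP[/and3P[_ _ wI]] /IHp H.
  by rewrite inE => /orP[/eqP-> //|/H].
pose P c := c :: rcons (pi c) t.
have sizeC : size (take k (enum C)) = k by rewrite size_takel // -cardE.
have memC c : c \in take k (enum C) -> c \in C by move/mem_take;
  rewrite mem_enum.
exists [seq P c | c <- take k (enum C)]; split.
- by rewrite size_map.
- by rewrite map_inj_uniq ?take_uniq ?enum_uniq // => c c' [].
- move=> _ /mapP[c /memC cC ->]; have [cA cp cB cU] := piP c cC.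
  have nt v : v \in c :: pi c -> (v != s) && (v != t) by move/(in_pi _ _ cC).
  have ct : c != t by have /andP[] := nt c (mem_head _ _).
  have nt2 : e (last c (pi c)) t && (last c (pi c) != s).
    by move: cB; rewrite inE => /andP[/andP[-> _] ->].
  split; [|by rewrite /P /= last_rcons|]; last first.
    rewrite -[s :: P c]/(rcons (s :: c :: pi c) t) rcons_uniq cons_uniq cU.
    rewrite in_cons eq_sym (negPf neq_st) andbT /=.
    by apply/andP; split; apply/negP=> /nt; rewrite eqxx ?andbF.
  rewrite /P /=.
  have -> : e s c by move: cA; rewrite inE => /andP[].
  rewrite rcons_path /= !xpair_eqE (negPf ct) andbF /=.
  case/andP: nt2 => -> /negPf->; rewrite /= andbT.
  apply: sub_path cp => u w /= /and3P[-> _ /andP[_ wt]].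
  by rewrite xpair_eqE (negPf wt) andbF.
- move=> _ _ v /mapP[c /memC cC ->] /mapP[c' /memC c'C ->] neq.
  rewrite /P -!rcons_cons !mem_rcons !(in_cons t).
  case/orP=> [/eqP->//|vc] /orP[/eqP->//|vc'].
  by rewrite (piD c c' v) ?eqxx in neq.
Qed.
End Menger.

(** * Polytopes in a linear subspace *)

Local Open Scope ring_scope.

Section Polytope.
Variables (R : realFieldType) (T : finType).
Implicit Types (x y u v w : {ffun T -> R^o}) (D : {set T}).
Implicit Types h phi : {ffun T -> R^o} -> R.

(** The ratio test: starting from a point [x] of the orthant on [D], one may
    move along [u] by a positive amount, and up to the boundary of the orthant
    if [u] has a negative coordinate. *)
Lemma ratio_test D x u :
  (forall e, e \in D -> 0 <= x e) ->
  (forall e, e \in D -> x e = 0 -> 0 <= u e) ->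
  exists t : R, [/\ 0 < t, forall e, e \in D -> 0 <= (x + t *: u) e &
    (exists2 e, e \in D & u e < 0) ->
    exists e, [/\ e \in D, u e < 0 & (x + t *: u) e = 0]].
Proof.
move=> x0 xu; have [e0 /andP[e0D ue0]|none] := pickP [pred e in D | u e < 0];
  last first.
  exists 1; split=> // [e eD|[e eD ue]]; last by have:= none e;
    rewrite /= eD ue.
  by rewrite !ffunE scale1r addr_ge0 ?x0 // leNgt; have:= none e;
    rewrite /= eD /= => ->.
have neg e : e \in D -> u e < 0 -> 0 < x e.
  by move=> eD ue; rewrite lt_def x0 // andbT; apply: contraTneq ue => /xu;
    rewrite -leNgt => ->.
case: (@arg_minP _ R _ e0 [pred e in D | u e < 0] (fun e => x e / - u e)) =>
  [|e /andP[eD ue] emin].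
  by rewrite /= e0D.
exists (x e / - u e); split=> [|e' e'D|_].
- by rewrite divr_gt0 ?oppr_gt0 ?neg.
- rewrite !ffunE; have [ue'|ue'] := ltP (u e') 0; last first.
    by rewrite addr_ge0 ?x0 // mulr_ge0 // divr_ge0 ?x0 // oppr_ge0 ltW.
  have := emin e'; rewrite /= e'D ue' => /(_ isT).
  by rewrite ler_pdivlMr ?oppr_gt0 // mulrN -subr_ge0 opprK.
- exists e; split=> //; rewrite !ffunE -[_ *: _]/(_ * _).
  by rewrite invrN mulrN mulNr -mulrA mulVf ?lt_eqF // mulr1 subrr.
Qed.

Variables (W : {ffun T -> R^o} -> Prop) (g : T) (H : {set T}).
Hypothesis W_lin : forall a u v, W u -> W v -> W (a *: u + v).
Hypothesis W_bnd : forall u,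
  W u -> u g = 0 -> (forall e, e \in H -> 0 <= u e) -> u = 0.

Lemma subspace_comb a u v : W u -> W v -> W (v + a *: u).
Proof. by move=> Wu Wv; rewrite addrC; apply: W_lin. Qed.

(** The slice at height 1 for [g] of the cone cut out of [W] by the constraints
    [H].  [W_bnd] says that it is bounded. *)
Definition polytope x := [/\ W x, x g = 1 & forall e, e \in H -> 0 <= x e].

(** A vertex is a point determined up to scaling by its set of tight
    constraints. *)
Definition vertex v := polytope v /\
  forall u, W u -> (forall e, e \in H -> v e = 0 -> u e = 0) -> u = u g *: v.

(** For distinct vertices, this says that the constraints tight at both cut out
    the plane spanned by [v] and [w], that is, [v] and [w] span an edge. *)
Definition adjacent v w := forall u, W u ->
  (forall e, e \in H -> v e = 0 -> w e = 0 -> u e = 0) ->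
  exists a b, u = a *: v + b *: w.

Lemma subspace0 x : W x -> W 0.
Proof. by move=> Wx; rewrite -(subrr x) addrC -scaleN1r; apply: W_lin. Qed.

Lemma scalar_comb h a u v : scalar h -> h (v + a *: u) = h v + a * h u.
Proof. by move=> hh; rewrite addrC hh addrC. Qed.

Lemma subspaceN u : W u -> W (- u).
Proof.
by move=> Wu; rewrite -scaleN1r -[_ *: _]addr0; apply: W_lin => //;
  apply: subspace0 Wu.
Qed.

Lemma scalar0 h : scalar h -> h 0 = 0.
Proof.
by move=> hh; have := hh (-1) 0 0; rewrite scaler0 addr0 mulN1r addNr.
Qed.

Lemma scalarN h u : scalar h -> h (- u) = - h u.
Proof.
by move=> hh; rewrite -scaleN1r -[_ *: _]addr0 hh scalar0 // addr0 mulN1r.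
Qed.

Lemma coord_scalar e : scalar (fun x : {ffun T -> R^o} => x e : R).
Proof. by move=> a u v; rewrite !ffunE. Qed.

Lemma exists_neg u : W u -> u g = 0 -> u != 0 -> exists2 e, e \in H & u e < 0.
Proof.
move=> Wu ug u0; have [e /andP[eH ue]|none] := pickP [pred e in H | u e < 0].
  by exists e.
case/eqP: u0; apply: W_bnd => // e eH; rewrite leNgt.
by have:= none e; rewrite /= eH /= => ->.
Qed.

(** A linear form takes its maximum over the polytope at a vertex: a point of
    smallest support among those at least as good as [x] is a vertex, as
    otherwise it could be moved to a proper face without decreasing [h]. *)
Lemma vertex_ge h x : scalar h -> polytope x ->
  exists2 w, vertex w & h x <= h w.
Proof.
move=> hh; have [n] := ubnP #|[set e in H | x e != 0]|.
elim: n x => // n IHn x le_n [Wx xg x0].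
have [vx|] := boolp.pselect (vertex x); first by exists x.
move=> /boolp.not_andP[[]//|/boolp.existsNP[u /boolp.not_implyP[Wu]]].
case/boolp.not_implyP=> xu neq.
have [u' [Wu' u'g xu' u'0 hu']] : exists u', [/\ W u', u' g = 0,
    forall e, e \in H -> x e = 0 -> u' e = 0, u' != 0 & 0 <= h u'].
  pose u1 := u + (- u g) *: x.
  have Wu1 : W u1 by apply: subspace_comb.
  have u1g : u1 g = 0 by rewrite !ffunE xg -[_ *: _]/(_ * _) mulr1 subrr.
  have xu1 e : e \in H -> x e = 0 -> u1 e = 0.
    by move=> eH xe; rewrite !ffunE (xu e eH xe) xe scaler0 addr0.
  have u10 : u1 != 0 by rewrite /u1 scaleNr subr_eq0; apply/eqP.
  have [|/ltW] := lerP 0 (h u1); first by exists u1.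
  rewrite -oppr_ge0 -scalarN //; exists (- u1); split; rewrite ?oppr_eq0 //.
  - exact: subspaceN.
  - by rewrite ffunE u1g oppr0.
  by move=> e eH xe; rewrite ffunE xu1 ?oppr0.
have [|t [t0 xt hit]] := @ratio_test H x u' x0; first by move=> e eH /xu'->.
have [|e [eH ue xe]] := hit; first exact: exists_neg.
have [||w vw hw] := IHn (x + t *: u').
- apply: leq_trans (le_n : (_ <= n)%N); apply: proper_card; apply/properP;
    split.
    apply/subsetP=> e'; rewrite !inE => /andP[e'H]; rewrite e'H /=.
    by apply: contraNneq => xe'; rewrite !ffunE xe' (xu' e') // scaler0 addr0.
  exists e; last by rewrite inE xe eqxx andbF.
  rewrite inE eH /=.
  by apply: contraTneq ue => xe0; rewrite xu' // ltxx.
- by split=> //; [apply: subspace_comb|rewrite !ffunE xg u'g scaler0 addr0].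
exists w => //; apply: le_trans hw; rewrite scalar_comb // lerDl.
by rewrite mulr_ge0 // ltW.
Qed.

(** If [y] spans an extreme ray of the tangent cone at [v], then moving along
    [y] until a constraint becomes tight leads to an adjacent vertex. *)
Lemma edge_along_ray v y t e1 : vertex v -> W y -> y g = 0 ->
  (forall u, W u -> u g = 0 ->
     (forall e, e \in H -> v e = 0 -> y e = 0 -> u e = 0) ->
     exists c : R, u = c *: y) ->
  0 < t -> (forall e, e \in H -> 0 <= (v + t *: y) e) ->
  e1 \in H -> y e1 < 0 -> (v + t *: y) e1 = 0 ->
  vertex (v + t *: y) /\ adjacent v (v + t *: y).
Proof.
move=> [[Wv vg v0] vP] Wy yg y1 t0 vt e1H ye1 vte1.
have w0 e : v e = 0 -> y e = 0 -> (v + t *: y) e = 0.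
  by move=> ve ye; rewrite !ffunE ve ye scaler0 addr0.
have line u : W u ->
    (forall e, e \in H -> v e = 0 -> y e = 0 -> u e = 0) ->
    exists c : R, u = u g *: v + c *: y.
  move=> Wu uP; have [|||c uE] := y1 (u + (- u g) *: v).
  - exact: subspace_comb.
  - by rewrite !ffunE vg -[_ *: _]/(_ * _) mulr1 subrr.
  - by move=> e eH ve ye; rewrite !ffunE (uP e eH ve ye) ve scaler0 addr0.
  by exists c; rewrite -uE scaleNr addrC subrK.
split; last first.
  move=> u Wu uP; have [|c ->] := line u Wu.
    by move=> e eH ve ye; apply: uP => //; apply: w0.
  exists (u g - c / t), (c / t).
  by rewrite scalerDr scalerA divfK ?gt_eqF // scalerBl addrA subrK.
split.
  split=> //; first exact: subspace_comb.
  by rewrite !ffunE vg yg scaler0 addr0.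
move=> u Wu uP; have [|c uE] := line u Wu.
  by move=> e eH ve ye; apply: uP => //; apply: w0.
rewrite {1}uE scalerDr scalerA; congr (_ + _ *: _).
have := uP _ e1H vte1; rewrite uE !ffunE; move: vte1; rewrite !ffunE.
rewrite -![_ *: _]/(_ * _ : R) vg yg mulr0 addr0 mulr1 => v1 uv.
apply: (mulIf (ltr0_neq0 ye1)).
have -> : c * y e1 = - (u g * v e1) by lra.
have -> : v e1 = - (t * y e1) by lra.
ring.
Qed.

(** Let [v] maximize [h], and let [y] be a tangent direction at [v] along
    which [h] is constant and [phi] increases. Then some edge at [v] has the
    same properties: a [y] of smallest support is an extreme ray of the
    tangent cone, since otherwise it can be moved within its face, in a
    direction where [phi] is constant, to a face of smaller dimension. *)
Lemma edge_in_cone h phi v y : scalar h -> scalar phi -> vertex v ->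
  (forall x, polytope x -> h x <= h v) ->
  W y -> y g = 0 -> (forall e, e \in H -> v e = 0 -> 0 <= y e) ->
  h y = 0 -> 0 < phi y ->
  exists w, [/\ vertex w, adjacent v w, h w = h v & phi v < phi w].
Proof.
move=> hh hphi vv vmax; have [[Wv vg v0] vP] := vv.
have cone_le u : W u -> u g = 0 -> (forall e, e \in H -> v e = 0 -> 0 <= u e) ->
    h u <= 0.
  move=> Wu ug u0; have [t [t0 vt _]] := @ratio_test H v u v0 u0.
  have : h (v + t *: u) <= h v.
    apply: vmax; split=> //; first exact: subspace_comb.
    by rewrite !ffunE vg ug scaler0 addr0.
  by rewrite scalar_comb // gerDl pmulr_rle0.
have [n] := ubnP #|[set e in H | (v e == 0) && (y e != 0)]|.
elim: n y => // n IHn y le_n Wy yg y0 hy phiy.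
pose ray u := forall e, e \in H -> v e = 0 -> y e = 0 -> u e = 0.
have [y1|] := boolp.pselect (forall u, W u -> u g = 0 -> ray u ->
    exists c : R, u = c *: y).
  have yn0 : y != 0 by apply: contraTneq phiy => ->; rewrite scalar0 ?ltxx.
  have [e eH ye] := exists_neg Wy yg yn0.
  have [t [t0 vt]] := @ratio_test H v y v0 y0.
  case=> [|e1 [e1H ye1 vte1]]; first by exists e.
  have [vw aw] := edge_along_ray vv Wy yg y1 t0 vt e1H ye1 vte1.
  exists (v + t *: y); split=> //; rewrite scalar_comb //.
    by rewrite hy mulr0 addr0.
  by rewrite ltrDl mulr_gt0.
case/boolp.existsNP=> u /boolp.not_implyP[Wu /boolp.not_implyP[ug]].
case/boolp.not_implyP=> ury nlin.
(* The direction [u1] lies in the span of the face of [y], and [phi] is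
   constant along it; the same holds for [h], as both [u1] and [- u1] can be
   followed. *)
pose u1 := u + (- (phi u / phi y)) *: y.
have Wu1 : W u1 by apply: subspace_comb.
have u1g : u1 g = 0 by rewrite !ffunE ug yg scaler0 addr0.
have u1ry : ray u1.
  by move=> e eH ve ye; rewrite !ffunE (ury e eH ve ye) ye scaler0 addr0.
have u10 : u1 != 0.
  by apply/eqP=> /eqP; rewrite /u1 scaleNr subr_eq0 => /eqP uE; case: nlin;
    eexists; exact: uE.
have phiu1 : phi u1 = 0 by rewrite scalar_comb // mulNr divfK ?gt_eqF // subrr.
have step u' : W u' -> u' g = 0 -> ray u' ->
    exists t, [/\ 0 < t, forall e, e \in H -> v e = 0 -> 0 <= (y + t *: u') e &
    (exists2 e, (e \in H) && (v e == 0) & u' e < 0) ->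
    exists e, [/\ e \in H, v e = 0, u' e < 0 & (y + t *: u') e = 0]].
  move=> Wu' u'g u'r.
  have [|e|t [t0 yt hit]] := @ratio_test [set e in H | v e == 0] y u'.
  - by move=> e; rewrite inE => /andP[eH /eqP ve]; apply: y0.
  - by rewrite inE => /andP[eH /eqP ve] ye; rewrite u'r.
  exists t; split=> // [e eH ve|[e eHv ue]].
    by apply: yt; rewrite inE eH ve eqxx.
  have [|e' [e'H ue' ye']] := hit; first by exists e => //; rewrite inE.
  by exists e'; move: e'H; rewrite inE => /andP[e'H /eqP ve']; split.
have h_le0 u' : W u' -> u' g = 0 -> ray u' -> h u' <= 0.
  move=> Wu' u'g u'r; have [t [t0 yt _]] := step u' Wu' u'g u'r.
  have : h (y + t *: u') <= 0.
    apply: cone_le => //; first exact: subspace_comb.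
    by rewrite !ffunE yg u'g scaler0 addr0.
  by rewrite scalar_comb // hy add0r pmulr_rle0.
have rayN u' : ray u' -> ray (- u').
  by move=> u'r e eH ve ye; rewrite ffunE u'r ?oppr0.
have gN u' : u' g = 0 -> (- u') g = 0 by move=> u'g; rewrite ffunE u'g oppr0.
have hu1 : h u1 = 0.
  apply/eqP; rewrite eq_le h_le0 //= -oppr_le0 -scalarN //.
  by apply: h_le0; [exact: subspaceN|exact: gN|exact: rayN].
have [u' [Wu' u'g u'r [hu' phiu'] [e eHv ue]]] :
    exists u', [/\ W u', u' g = 0, ray u', h u' = 0 /\ phi u' = 0 &
      exists2 e, (e \in H) && (v e == 0) & u' e < 0].
  have [e [eH ve ue]] : exists e, [/\ e \in H, v e = 0 & u1 e != 0].
    apply: boolp.contrapT => none; case/eqP: u10.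
    rewrite (vP u1) ?u1g ?scale0r // => e eH ve.
    by apply: boolp.contrapT => ue; case: none; exists e; split=> //; apply/eqP.
  move: ue; rewrite neq_lt => /orP[ue|ue].
    by exists u1; split=> //; exists e => //; rewrite eH ve eqxx.
  exists (- u1); rewrite !scalarN // hu1 phiu1 oppr0; split=> //.
  - exact: subspaceN.
  - exact: gN.
  - exact: rayN.
  by exists e; rewrite ?eH ?ve ?eqxx // ffunE oppr_lt0.
have [t [t0 yt]] := step u' Wu' u'g u'r.
case=> [|e1 [e1H ve1 ue1 yte1]]; first by exists e.
apply: (IHn (y + t *: u')) => //.
- apply: leq_trans (le_n : (_ <= n)%N); apply: proper_card; apply/properP;
    split.
    apply/subsetP=> e'; rewrite !inE => /and3P[e'H /eqP ve' yte'].
    rewrite e'H ve' eqxx; apply: contraNneq yte' => ye'.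
    by rewrite !ffunE (u'r e' e'H ve' ye') ye' scaler0 addr0.
  exists e1; last by rewrite inE yte1 eqxx !andbF.
  rewrite inE e1H ve1 eqxx /=.
  by apply: contraTneq ue1 => ye1; rewrite u'r // ltxx.
- exact: subspace_comb.
- by rewrite !ffunE yg u'g scaler0 addr0.
- by rewrite scalar_comb // hy hu' mulr0 addr0.
- by rewrite scalar_comb // phiu' mulr0 addr0.
Qed.

(** The direction from a vertex to another point lies in the tangent cone. *)
Lemma polytope_dir v x : vertex v -> polytope x ->
  [/\ W (x - v), (x - v) g = 0 &
    forall e, e \in H -> v e = 0 -> 0 <= (x - v) e].
Proof.
move=> [[Wv vg v0] _] [Wx xg x0]; split.
- by rewrite -scaleN1r; apply: subspace_comb.
- by rewrite !ffunE vg xg subrr.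
- by move=> e eH ve; rewrite !ffunE ve subr0 x0.
Qed.

Lemma scalarB h u v : scalar h -> h (u - v) = h u - h v.
Proof. by move=> hh; rewrite -scaleN1r scalar_comb // mulN1r. Qed.

Lemma improving_edge phi v x : scalar phi -> vertex v -> polytope x ->
  phi v < phi x -> exists w, [/\ vertex w, adjacent v w & phi v < phi w].
Proof.
move=> hphi vv xP lt_vx; have [Wy yg y0] := polytope_dir vv xP.
have h0 : scalar (fun _ : {ffun T -> R^o} => 0 : R) by move=> a u u';
  rewrite mulr0 addr0.
have phiy : 0 < phi (x - v) by rewrite scalarB // subr_gt0.
have [w [vw aw _ lt_vw]] :=
  edge_in_cone h0 hphi vv (fun _ _ => lexx _) Wy yg y0 erefl phiy.
by exists w.
Qed.

(** A linear form that is constant on no edge has only one maximum point. *)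
Lemma unique_max phi v x : scalar phi ->
  (forall v' w', vertex v' -> vertex w' -> adjacent v' w' ->
    phi v' = phi w' -> v' = w') ->
  vertex v -> (forall y, polytope y -> phi y <= phi v) -> polytope x ->
  phi x = phi v -> x = v.
Proof.
move=> hphi gen vv vmax xP eq_xv; have [Wy yg y0] := polytope_dir vv xP.
have [[Wv vg v0] vP] := vv.
apply/eqP; rewrite -subr_eq0; apply: contraT => yn0.
have [e [eH ve ye]] : exists e, [/\ e \in H, v e = 0 & 0 < (x - v) e].
  apply: boolp.contrapT => none; case/eqP: yn0.
  rewrite (vP (x - v)) ?yg ?scale0r // => e eH ve.
  apply/eqP; rewrite eq_le y0 // andbT leNgt; apply/negP=> ye.
  by case: none; exists e.
have [|//|w [vw aw hw]] := edge_in_cone hphi (coord_scalar e) vv vmax Wy yg y0.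
  by rewrite scalarB // eq_xv subrr.
by rewrite -(gen v w) ?ltxx.
Qed.

(** The vertices are the points [pt i] with [i] in [A]; the linear form [phi]
    has a unique minimum at [s] and a unique maximum at [t]. *)
Section Walk.
Variables (I : finType) (A : {set I}) (pt : I -> {ffun T -> R^o}).
Variables (phi : {ffun T -> R^o} -> R) (s t : I).
Hypothesis hphi : scalar phi.
Hypothesis ptA : forall i, i \in A -> vertex (pt i).
Hypothesis pt_onto : forall v, vertex v -> exists2 i, i \in A & pt i = v.
Hypothesis sA : s \in A.
Hypothesis tA : t \in A.
Hypothesis s_min : forall i, i \in A -> i != s -> phi (pt s) < phi (pt i).
Hypothesis t_max : forall i, i \in A -> i != t -> phi (pt i) < phi (pt t).

(** An edge along which [phi] increases. *)
Definition mono_edge i j :=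
  [/\ i \in A, j \in A, adjacent (pt i) (pt j) & phi (pt i) < phi (pt j)].

Definition maximizes h v := forall x, polytope x -> h x <= h v.

(** The objectives of the parametric simplex method. *)
Definition tilt (l : {ffun T -> R^o} -> R) (a : R) x : R := l x + a * phi x.

(** A monotone edge that projects to the upper boundary of the shadow of the
    polytope under [(phi, l)]: some [tilt l a] is maximal on all of it. *)
Definition shadow_edge l i j :=
  mono_edge i j /\
  exists a, maximizes (tilt l a) (pt i) /\ maximizes (tilt l a) (pt j).

Lemma tilt_scalar l a : scalar l -> scalar (tilt l a).
Proof. by move=> hl b u v; rewrite /tilt hl hphi; ring. Qed.

Lemma max_on_vertices h v : scalar h ->
  (forall i, i \in A -> h (pt i) <= h v) -> maximizes h v.
Proof.
move=> hh vmax x xP; have [w vw hw] := vertex_ge hh xP.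
by have [i iA iw] := pt_onto vw; apply: le_trans hw _; rewrite -iw vmax.
Qed.

(** From a vertex other than [t] on the upper boundary, increase the slope [a]
    up to the least value [rho j] at which a vertex with larger [phi] becomes
    optimal too; the face of optimal points then has an increasing edge at [pt
    i]. *)
Lemma shadow_step l a i : scalar l -> i \in A -> i != t ->
  maximizes (tilt l a) (pt i) -> exists j, shadow_edge l i j.
Proof.
move=> hl iA nit imax.
pose rho j := (l (pt i) - l (pt j)) / (phi (pt j) - phi (pt i)).
pose up := [pred j in A | phi (pt i) < phi (pt j)].
have up_t : up t by rewrite /= tA t_max.
case: (@arg_minP _ R _ t up rho up_t) => j /andP[jA ij] jmin.
have le_a b k : phi (pt i) < phi (pt k) ->
    (tilt l b (pt k) <= tilt l b (pt i)) = (b <= rho k).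
  move=> ik; rewrite ler_pdivlMr ?subr_gt0 // /tilt; apply/idP/idP; lra.
have aj : a <= rho j by rewrite -le_a // imax //; case: (ptA jA).
have imax' : maximizes (tilt l (rho j)) (pt i).
  apply: max_on_vertices => [|k kA]; first exact: tilt_scalar.
  have [ik|ki] := ltP (phi (pt i)) (phi (pt k)).
    by rewrite le_a // jmin //= kA.
  have [kP _] := ptA kA; have := imax _ kP; rewrite /tilt.
  have := ler_wpM2r (_ : 0 <= phi (pt i) - phi (pt k)) aj.
  by rewrite subr_ge0 => /(_ ki); lra.
have eqj : tilt l (rho j) (pt j) = tilt l (rho j) (pt i).
  rewrite /tilt; have : rho j * (phi (pt j) - phi (pt i)) = l (pt i) - l (pt j).
    by rewrite divfK // subr_eq0 gt_eqF.
  by lra.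
have [Wy yg y0] := polytope_dir (ptA iA) (ptA jA).1.
have [||w [vw aw hw phiw]] :=
  edge_in_cone (tilt_scalar (rho j) hl) hphi (ptA iA) imax' Wy yg y0.
- by rewrite scalarB ?eqj ?subrr //; apply: tilt_scalar.
- by rewrite scalarB // subr_gt0.
have [k kA kw] := pt_onto vw; exists k; split; first by rewrite /mono_edge kw.
by exists (rho j); split=> // x xP; rewrite kw hw; apply: imax'.
Qed.

(** The upper boundary carries a monotone path from [s] to [t]. It starts at
    [s], which maximizes [tilt l a] for very negative [a]. *)
Lemma shadow_path l : scalar l ->
  exists p, path (fun i j => boolp.asbool (shadow_edge l i j)) s p /\
    last s p = t.
Proof.
move=> hl.
have [a smax] : exists a, maximizes (tilt l a) (pt s).
  pose rho j := (l (pt s) - l (pt j)) / (phi (pt j) - phi (pt s)).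
  exists (- \sum_(j in A) `|rho j|).
  apply: max_on_vertices => [|j jA]; first exact: tilt_scalar.
  have [->//|/(s_min jA) sj] := eqVneq j s.
  have : - (\sum_(j in A) `|rho j|) <= rho j.
    rewrite lerNl; apply: le_trans (ler_norm _) _; rewrite normrN.
    by rewrite (bigD1 j) //= lerDl sumr_ge0.
  rewrite ler_pdivlMr ?subr_gt0 // /tilt; lra.
have [n] := ubnP #|[set j in A | phi (pt s) < phi (pt j)]|.
move: (s) sA a smax; clear s_min sA s.
elim: n => // n IHn i iA a imax le_n.
have [->|nit] := eqVneq i t; first by exists [::].
have [j ij] := shadow_step hl iA nit imax.
have [[_ jA _ lt_ij] [b [_ jmax]]] := ij.
have [|p [jp lp]] := IHn j jA b jmax.
  apply: leq_trans (le_n : (_ <= n)%N); apply: proper_card; apply/properP;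
    split.
    by apply/subsetP=> k; rewrite !inE => /andP[-> /(lt_trans lt_ij)].
  by exists j; rewrite !inE ?jA //= ltxx.
by exists (j :: p); split=> //=; rewrite jp andbT; apply/boolp.asboolP.
Qed.

(** If [l] vanishes at [s] but not on the whole polytope, some monotone path
    from [s] to [t] meets the zero set of [l] at [s] and possibly [t] only; if
    [l] vanishes at [t], this path does not use the arc from [s] to [t]. *)
Lemma avoiding_path l : scalar l -> l (pt s) = 0 ->
  (exists2 x, polytope x & l x != 0) ->
  exists p, [/\ path (fun i j => boolp.asbool (mono_edge i j)) s p,
    last s p = t,
    forall i, i \in p -> l (pt i) = 0 -> i = t &
    l (pt t) = 0 ->
    path (fun i j => boolp.asbool (mono_edge i j) && ((i, j) != (s, t))) s p].
Proof.
move=> hl ls0 [x xP lx].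
(* Replacing [l] by [- l] makes [l] nonnegative at [t], and positive at [x] in
   case it vanishes at [t]. *)
wlog [lt0 lx0] : l hl ls0 lx / 0 <= l (pt t) /\ (l (pt t) = 0 -> 0 < l x).
  move=> Hw; have hNl : scalar (fun y => - l y).
    by move=> a u v; rewrite hl mulrN opprD.
  have Hw' := Hw _ hNl; rewrite ls0 oppr0 oppr_eq0 in Hw'.
  have {}Hw' := Hw' erefl lx.
  have use : 0 <= - l (pt t) /\ (- l (pt t) = 0 -> 0 < - l x) ->
    exists p, [/\ path (fun i j => boolp.asbool (mono_edge i j)) s p,
    last s p = t,
    forall i, i \in p -> l (pt i) = 0 -> i = t &
    l (pt t) = 0 ->
    path (fun i j => boolp.asbool (mono_edge i j) && ((i, j) != (s, t))) s p].
    move=> /Hw'[p [p1 p2 p3 p4]]; exists p; split=> // [i ip li|lt].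
      by apply: p3; rewrite ?li ?oppr0.
    by apply: p4; rewrite lt oppr0.
  have [lt|lt|lt] := ltrgtP (l (pt t)) 0.
  - by apply: use; lra.
  - by apply: (Hw l) => //; lra.
  have [lxn|lxp|lxe] := ltrgtP (l x) 0.
  - by apply: use; lra.
  - by apply: (Hw l) => //; lra.
  by rewrite lxe eqxx in lx.
have [p [sp lp]] := shadow_path hl; exists p; split=> //.
- by apply: sub_path sp => i j /boolp.asboolP[? _]; apply/boolp.asboolP.
(* An inner vertex [i] with [l = 0] that maximizes [tilt l a] is compared with
   [s], giving [a >= 0], and with [t], giving [a <= 0]; so [l] is at most 0 on
   the polytope, but it is positive at [x] when it vanishes at [t]. *)
- move=> i ip li; apply: boolp.contrapT => /eqP nit.
  have [iA si [a imax]] : [/\ i \in A, phi (pt s) < phi (pt i) &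
      exists a, maximizes (tilt l a) (pt i)].
    move: (s) p sp ip {lp}; clear; move=> s p.
    elim: p s => //= j p IHp s' /andP[/boolp.asboolP[[_ jA _ sj] [a [_ jmax]]]
      jp].
    rewrite inE => /orP[/eqP->|ip]; first by split=> //; exists a.
    by have [iA ji ex] := IHp j jp ip; split=> //; apply: lt_trans ji.
  have ti := t_max iA nit.
  have [sP tP] := ((ptA sA).1, (ptA tA).1).
  have := imax _ sP; have := imax _ tP; have := imax _ xP.
  rewrite /tilt li ls0 !add0r => xi t_i s_i.
  have a0 : 0 <= a by rewrite -(pmulr_lge0 a (_ :
    0 < phi (pt i) - phi (pt s))) ?subr_gt0 // mulrBr subr_ge0.
  have a0' : a * (phi (pt t) - phi (pt i)) <= 0 by rewrite mulrBr; lra.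
  have az : a = 0.
    by apply/eqP; rewrite eq_le a0 andbT -(pmulr_lle0 a (_ :
      0 < phi (pt t) - phi (pt i))) // subr_gt0.
  rewrite az !mul0r addr0 in xi t_i; have : l (pt t) = 0 by lra.
  by move/lx0; lra.
(* If [s] and [t] both maximize [tilt l a] then [a = 0], so [l <= 0] on [P]. *)
- move=> lt; apply: sub_path sp => i j /boolp.asboolP[ij [a [imax jmax]]].
  apply/andP; split; first exact/boolp.asboolP.
  apply/negP=> /eqP[iE jE]; rewrite {}iE {}jE in ij imax jmax.
  have [_ _ _ lt_st] := ij; have [sP tP] := ((ptA sA).1, (ptA tA).1).
  have := imax _ tP; have := jmax _ sP; have := imax _ xP.
  rewrite /tilt ls0 lt !add0r => xs s_t t_s.
  have az : a = 0.
    have /eqP : a * (phi (pt t) - phi (pt s)) = 0 by rewrite mulrBr; lra.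
    by rewrite mulf_eq0 => /orP[/eqP//|]; rewrite subr_eq0 gt_eqF.
  by rewrite az !mul0r addr0 in xs; have := lx0 lt; lra.
Qed.
End Walk.
End Polytope.

(** * Oriented matroids of sign vectors of a subspace *)

Section Signs.
Variable R : realType.
Implicit Types a b : R.

Lemma sign_of_eq0 a : (sign_of a == Zero) = (a == 0).
Proof. by rewrite /sign_of; case: ifP => // _; case: ifP. Qed.

Lemma sign_of_pos a : (sign_of a == Pos) = (0 < a).
Proof. by rewrite /sign_of; case: (eqVneq a 0) => [->|_];
  [rewrite ltxx|case: ifP]. Qed.

Lemma sign_of_neg a : (sign_of a == Neg) = (a < 0).
Proof.
rewrite /sign_of; case: (eqVneq a 0) => [->|a0]; first by rewrite ltxx.
by case: ifP => [/lt_gtF->//|/negbT]; rewrite -leNgt lt_neqAle a0 => ->.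
Qed.

Lemma nonneg_sign_of a : nonneg (sign_of a) = (0 <= a).
Proof. by rewrite /nonneg sign_of_eq0 sign_of_pos le_eqVlt orbC eq_sym. Qed.

Lemma sign_of_opp a : sign_of (- a) = sopp (sign_of a).
Proof.
rewrite /sign_of oppr_eq0; case: (eqVneq a 0) => // a0; rewrite oppr_gt0.
by move: a0; case: ltrgtP.
Qed.

Lemma sign_ofM a b : 0 < a -> sign_of (a * b) = sign_of b.
Proof. by move=> a0; rewrite /sign_of mulf_eq0 gt_eqF //= pmulr_rgt0. Qed.

End Signs.

Section Realizations.
Variables (R : realType) (T : finType).
Implicit Types (N : orientedMatroid T) (W : {ffun T -> R^o} -> Prop).
Implicit Types (x u w : {ffun T -> R^o}) (A : {set T}).

(** The type [R^o] is [R] as a module over itself, so that [{ffun T -> R^o}] is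
    the vector space R^T. *)
Definition sign_vector x : svec T := [ffun e => sign_of (x e : R)].

(** The subspace [W] of R^T realizes [N] if its sign vectors are the covectors
    of [N]. No condition on the dimension of [W] is needed, and coordinates
    outside the ground set vanish on [W]. *)
Definition realizes W N : Prop :=
  (forall a u v, W u -> W v -> W (a *: u + v)) /\
  (forall X, X \in covectors N <-> exists2 w, W w & X = sign_vector w).

(** The subspace is the image of the map sending a point to its products with
    the vectors of the realization. *)
Lemma realizes_representable N : representable R N -> exists W, realizes W N.
Proof.
case=> v vP; pose val (z : 'rV[R]_(om_rank N)) e :=
  \sum_i v e ord0 i * z ord0 i.
exists (fun w => exists z : 'rV[R]_(om_rank N),
  w = [ffun e => if e \in ground N then val z e else 0]); split.
  move=> a _ _ [x ->] [y ->]; exists (a *: x + y); apply/ffunP=> e.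
  rewrite !ffunE; case: ifP => _; last by rewrite scaler0 addr0.
  rewrite -[_ *: _]/(_ * _) mulr_sumr -big_split; apply: eq_bigr => i _ /=.
  by rewrite !mxE; ring.
move=> X; rewrite vP; split=> [[x ->]|[_ [x ->] ->]].
  exists [ffun e => if e \in ground N then val x e else 0]; first by exists x.
  by apply/ffunP=> e; rewrite !ffunE; case: ifP => //; rewrite /sign_of eqxx.
exists x; apply/ffunP=> e; rewrite !ffunE; case: ifP => //.
by rewrite /sign_of eqxx.
Qed.

Lemma realizes_reorientation W N A : realizes W N ->
  exists W', realizes W' (reorientation N A).
Proof.
move=> [Wlin WP]; pose r w : {ffun T -> R^o} := [ffun e =>
  if e \in A then - w e else w e].
have rE w : sign_vector (r w) = svreorient A (sign_vector w).
  by apply/ffunP=> e; rewrite !ffunE; case: ifP => // _; rewrite sign_of_opp.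
exists (fun u => exists2 w, W w & u = r w); split.
  move=> a _ _ [u Wu ->] [v Wv ->]; exists (a *: u + v); first exact: Wlin.
  by apply/ffunP=> e; rewrite !ffunE; case: ifP => // _; rewrite opprD scalerN.
move=> X; split=> [/imsetP[Y /WP[w Ww ->] ->]|[_ [w Ww ->] ->]].
  by exists (r w); rewrite ?rE //; exists w.
by rewrite rE; apply/imset_f/WP; exists w.
Qed.

Lemma realizes_deletion W N A : realizes W N ->
  exists W', realizes W' (deletion N A).
Proof.
move=> [Wlin WP]; pose r w : {ffun T -> R^o} := [ffun e =>
  if e \in A then 0 else w e].
have rE w : sign_vector (r w) = svdelete A (sign_vector w).
  by apply/ffunP=> e; rewrite !ffunE; case: ifP => // _; rewrite /sign_of eqxx.
exists (fun u => exists2 w, W w & u = r w); split.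
  move=> a _ _ [u Wu ->] [v Wv ->]; exists (a *: u + v); first exact: Wlin.
  by apply/ffunP=> e; rewrite !ffunE; case: ifP => // _; rewrite scaler0 addr0.
move=> X; split=> [/imsetP[Y /WP[w Ww ->] ->]|[_ [w Ww ->] ->]].
  by exists (r w); rewrite ?rE //; exists w.
by rewrite rE; apply/imset_f/WP; exists w.
Qed.

Lemma realizes_contraction W N A : realizes W N ->
  exists W', realizes W' (contraction N A).
Proof.
move=> [Wlin WP]; exists (fun w => W w /\ forall e, e \in A -> w e = 0); split.
  move=> a u v [Wu uA] [Wv vA]; split=> [|e eA]; first exact: Wlin.
  by rewrite !ffunE uA ?vA // scaler0 addr0.
move=> X; rewrite inE; split=> [/andP[/WP[w Ww ->] /forall_inP XA]|[w [Ww wA]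
  ->]].
  exists w => //; split=> // e /XA; rewrite ffunE sign_of_eq0 => /eqP.
  exact.
apply/andP; split; first by apply/WP; exists w.
by apply/forall_inP=> e eA; rewrite ffunE sign_of_eq0 wA.
Qed.

Lemma realizes_obtained W N N' : realizes W N -> obtained N N' ->
  exists W', realizes W' N'.
Proof.
move=> WN; elim=> [|N1 A _ [W1 W1P]|N1 A _ [W1 W1P]|N1 A _ [W1 W1P]].
- by exists W.
- exact: realizes_reorientation W1P.
- exact: realizes_deletion W1P.
- exact: realizes_contraction W1P.
Qed.

End Realizations.

(** * The polytope of a proper program *)

Section ProperProgram.
Variables (R : realType) (T : finType) (N : orientedMatroid T).
Variables (W : {ffun T -> R^o} -> Prop) (g f : T).
Hypothesis WN : realizes W N.
Hypothesis proper : proper_program N g f.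
Implicit Types (x y u v w : {ffun T -> R^o}) (X Y V : svec T).

(* The constraints of the program. *)
Let H : {set T} := ground N :\: [set g; f].
Let Wlin : forall a u v, W u -> W v -> W (a *: u + v) := WN.1.
Let WP : forall X,
  X \in covectors N <-> exists2 w, W w & X = sign_vector w := WN.2.
Local Notation polytope := (polytope W g H).
Local Notation vertex := (vertex W g H).
Local Notation adjacent := (adjacent W H).

Lemma obj_neq : f != g. Proof. by case: proper => -[]. Qed.

Lemma sign_vectorP w : W w -> sign_vector w \in covectors N.
Proof. by move=> Ww; apply/WP; exists w. Qed.

Lemma out_ground w e : W w -> e \notin ground N -> w e = 0.
Proof.
move=> Ww eG; apply/eqP; rewrite -sign_of_eq0.
by have := covector_supp (sign_vectorP Ww) eG; rewrite ffunE => ->.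
Qed.

Lemma ground_cases e : [\/ e = g, e = f, e \in H | e \notin ground N].
Proof.
rewrite !inE; case: (eqVneq e g) => [|_]; first by constructor 1.
case: (eqVneq e f) => [|_]; first by constructor 2.
by case: (boolP (e \in ground N)) => eG; [constructor 3|constructor 4].
Qed.

Lemma constraint_neq e : e \in H -> e != g /\ e != f.
Proof. by rewrite !inE negb_or -andbA => /and3P[-> ->]. Qed.

Lemma nonneg_off_signP w :
  reflect (forall e, e \in H -> 0 <= w e) (nonneg_off N g f (sign_vector w)).
Proof.
apply: (iffP forall_inP) => w0 e /w0; first by rewrite ffunE nonneg_sign_of.
by rewrite ffunE nonneg_sign_of.
Qed.

(** As [f] is not a coloop, a point of [W] is determined by its coordinates
    other than [f]. *)
Lemma eq_off_f u : W u -> (forall e, e != f -> u e = 0) -> u = 0.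
Proof.
move=> Wu u0; have uf : u f = 0.
  have [[_ _ fG _]] := proper; rewrite /coloop fG negbK inE fG => /=.
  move/forall_inP=> /(_ _ (sign_vectorP Wu)) /implyP.
  rewrite !ffunE sign_of_eq0 => imp _ _ _; apply/eqP/imp/forall_inP=> e.
  by rewrite !inE => /andP[ef _]; rewrite ffunE sign_of_eq0 u0.
by apply/ffunP=> e; rewrite ffunE; case: (eqVneq e f) => [->|/u0].
Qed.

Lemma sign_vector_neq0 x : x != 0 -> sign_vector x != szero T.
Proof.
apply: contraNneq => /ffunP s0; apply/eqP/ffunP=> e; rewrite ffunE.
by apply/eqP; rewrite -sign_of_eq0; have := s0 e; rewrite !ffunE => ->.
Qed.

(** A nonzero [u] as below would be a direction in which the program is
    unbounded. *)
Lemma polytope_bounded u :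
  W u -> u g = 0 -> (forall e, e \in H -> 0 <= u e) -> u = 0.
Proof.
move=> Wu ug u0; apply: boolp.contrapT => /eqP un0.
have [_ + [X XF _] _] := proper; case; split; first by apply/set0Pn; exists X.
exists (sign_vector u); split; [exact: sign_vectorP|exact:
  sign_vector_neq0| |exact/nonneg_off_signP].
by apply/eqP; rewrite ffunE sign_of_eq0 ug.
Qed.

Lemma subspaceZ a u : W u -> W (a *: u).
Proof. by move=> Wu; rewrite -[_ *: _]addr0; apply: Wlin => //;
  apply: subspace0 Wlin _ Wu. Qed.

(** A feasible tope gives a point where only the loops among the constraints
    are tight. *)
Lemma interior_point : exists2 x, polytope x &
  forall e, e \in H -> x e = 0 -> forall w, W w -> w e = 0.
Proof.
have [_ _ [X]] := proper.
rewrite inE => /and3P[/WP[x Wx ->] xg /nonneg_off_signP x0] /andP[_ /forall_inP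
  xmax] _.
rewrite ffunE sign_of_pos in xg.
exists ((x g)^-1 *: x).
  split; [exact: subspaceZ|by rewrite ffunE -[_ *: _]/(_ * _ :
    R) mulVf ?gt_eqF|].
  by move=> e eH; rewrite ffunE mulr_ge0 ?x0 // invr_ge0 ltW.
move=> e eH; rewrite ffunE => /eqP; rewrite -[_ *: _]/(_ * _ : R).
rewrite mulf_eq0 invr_eq0 gt_eqF //= => /eqP xe w Ww.
have := xmax _ (covector_comp (sign_vectorP Wx) (sign_vectorP Ww)).
have -> : sle (sign_vector x) (scomp (sign_vector x) (sign_vector w)).
  by apply/forallP=> e'; rewrite !ffunE; case: ifP; rewrite ?eqxx ?orbT.
move=> /eqP/ffunP/(_ e); rewrite !ffunE xe {1}/sign_of eqxx /= => we.
by apply/eqP; rewrite -sign_of_eq0 we /sign_of eqxx.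
Qed.

(** The covector of the deletion of [f] given by a point of [W]. *)
Definition offsign x : svec T := svdelete [set f] (sign_vector x).

Lemma offsignE x e : e != f -> offsign x e = sign_of (x e).
Proof. by move=> ef; rewrite !ffunE inE (negPf ef). Qed.

Lemma offsign_f x : offsign x f = Zero.
Proof. by rewrite !ffunE inE eqxx. Qed.

Lemma offsign_eq0 x e : e != f -> (offsign x e == Zero) = (x e == 0).
Proof. by move=> ef; rewrite offsignE // sign_of_eq0. Qed.

Lemma deletion_covectorP X :
  reflect (exists2 x, W x & X = offsign x)
    (X \in covectors (deletion N [set f])).
Proof.
apply: (iffP imsetP) => [[Y /WP[x Wx ->] ->]|[x Wx ->]]; first by exists x.
by exists (sign_vector x) => //; apply: sign_vectorP.
Qed.

Lemma offsign_covector x : W x -> offsign x \in covectors (deletion N [set f]).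
Proof. by move=> Wx; apply/deletion_covectorP; exists x. Qed.

Lemma offsign_scale a x : 0 < a -> offsign (a *: x) = offsign x.
Proof.
move=> a0; apply/ffunP=> e; rewrite !ffunE -[_ *: _]/(_ * _ : R).
by rewrite sign_ofM.
Qed.

Lemma offsign_neq0 x : W x -> x != 0 -> offsign x != szero T.
Proof.
move=> Wx; apply: contraNneq => x0; apply/eqP/eq_off_f => // e ef.
by apply/eqP; rewrite -offsign_eq0 // x0 ffunE.
Qed.

Lemma offsign_szero x : offsign x != szero T -> x != 0.
Proof.
by apply: contraNneq => ->; apply/eqP/ffunP=> e;
  rewrite !ffunE /sign_of eqxx if_same.
Qed.

Lemma sle_offsign y V e : sle (offsign y) V -> e != f -> V e = Zero -> y e = 0.
Proof.
move=> /forallP/(_ e) + ef Ve; rewrite Ve orbb offsign_eq0 //.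
by move/eqP.
Qed.

Lemma vertex_feasible v : vertex v -> offsign v \in feasible_vertices N g f.
Proof.
move=> [[Wv vg v0] vP]; have gf : g != f by rewrite eq_sym obj_neq.
have Vg : offsign v g = Pos by rewrite offsignE // vg; apply/eqP;
  rewrite sign_of_pos ltr01.
rewrite !inE Vg eqxx andbT; apply/andP; split; last first.
  apply/forall_inP=> e eH; have [_ ef] := constraint_neq eH.
  by rewrite offsignE // nonneg_sign_of v0.
apply/and3P; split; first exact: offsign_covector.
  by apply/eqP=> /ffunP/(_ g); rewrite Vg ffunE.
apply/forall_inP=> _ /deletion_covectorP[y Wy ->]; apply/implyP=> /andP[y0 yV].
have yE : y = y g *: v.
  apply: vP => // e eH ve; have [_ ef] := constraint_neq eH.
  by apply: (sle_offsign yV) => //; apply/eqP; rewrite offsign_eq0 // ve.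
have yg : 0 < y g.
  have /forallP/(_ g) := yV; rewrite Vg offsignE // sign_of_eq0 sign_of_pos.
  case/orP=> // /eqP yg; case/eqP: (offsign_szero y0).
  by rewrite yE yg scale0r.
by rewrite yE offsign_scale.
Qed.

(** Conversely, let the point [v] represent a feasible vertex. If its tight
    constraints did not determine [v], then moving within the face of [v] to
    its boundary would give a covector strictly below the cocircuit [V]. *)
Lemma feasible_vertex V : V \in feasible_vertices N g f ->
  exists2 v, vertex v & V = offsign v.
Proof.
have gf : g != f by rewrite eq_sym obj_neq.
rewrite !inE => /andP[/andP[/and3P[/deletion_covectorP[v' Wv' VE] V0
  /forall_inP Vmin] /eqP Vg] /forall_inP Vn].
have vg' : 0 < v' g by rewrite -sign_of_pos -offsignE // -VE Vg.
pose v := (v' g)^-1 *: v'.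
have {}VE : V = offsign v by rewrite VE offsign_scale // invr_gt0.
have Wv : W v by apply: subspaceZ.
have vg : v g = 1 by rewrite ffunE -[_ *: _]/(_ * _ : R) mulVf // gt_eqF.
have v0 e : e \in H -> 0 <= v e.
  by move=> eH; have := Vn e eH; rewrite VE offsignE ?nonneg_sign_of //;
    case: (constraint_neq eH).
clearbody v; exists v => //; split=> // u Wu vu; apply: boolp.contrapT => neq.
pose u1 := u + (- u g) *: v.
have Wu1 : W u1 by apply: subspace_comb.
have u1g : u1 g = 0 by rewrite !ffunE vg -[_ *: _]/(_ * _) mulr1 subrr.
have u10 : u1 != 0 by rewrite /u1 scaleNr subr_eq0; apply/eqP.
have vu1 e : e \in H -> v e = 0 -> u1 e = 0.
  by move=> eH ve; rewrite !ffunE (vu e eH ve) ve scaler0 addr0.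
clearbody u1.
have [|t [t0 xt hit]] := @ratio_test R T H v u1 v0; first by move=> e eH /vu1->.
have [e [eH ue xe]] := hit (exists_neg polytope_bounded Wu1 u1g u10).
have Wy : W (v + t *: u1) by apply: subspace_comb.
have yg : (v + t *: u1) g = 1 by rewrite !ffunE vg u1g scaler0 addr0.
have [_ ef] := constraint_neq eH.
suff /eqP/ffunP/(_ e) : offsign (v + t *: u1) == V.
  rewrite VE !offsignE // xe {1}/sign_of eqxx => /esym/eqP.
  by rewrite sign_of_eq0 => /eqP /(vu1 _ eH) ue0; rewrite ue0 ltxx in ue.
have /implyP -> // := Vmin _ (offsign_covector Wy).
rewrite offsign_neq0 //=; last first.
  by apply: contra_eq_neq yg => ->; rewrite ffunE eq_sym oner_eq0.
apply/forallP=> e'; have [->|->|e'H|e'G] := ground_cases e'.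
- by rewrite Vg !offsignE // yg sign_of_pos ltr01 orbT.
- by rewrite offsign_f.
- have [_ e'f] := constraint_neq e'H; rewrite offsign_eq0 // VE !offsignE //.
  have [ve|ve] := eqVneq (v e') 0.
    by rewrite !ffunE (vu1 e' e'H ve) ve scaler0 addr0 eqxx orbT.
  have [//|ye] := eqVneq ((v + t *: u1) e') 0.
  have /eqP-> : sign_of ((v + t *: u1) e') == Pos by rewrite sign_of_pos lt_def
    ye xt.
  by rewrite eq_sym sign_of_pos lt_def ve v0.
- have e'f : e' != f by apply: contraNneq e'G => ->; case: proper => -[].
  by rewrite offsign_eq0 // out_ground ?eqxx.
Qed.

Lemma vertex_offsign_inj v w : vertex v -> vertex w ->
  offsign v = offsign w -> v = w.
Proof.
move=> [[_ _ _] vP] [[Ww wg _] _] vw; rewrite [RHS](vP w) ?wg ?scale1r // =>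
  e eH ve.
have [_ ef] := constraint_neq eH.
by apply/eqP; rewrite -offsign_eq0 // -vw offsign_eq0 // ve.
Qed.

(** Distinct vertices are separated by a constraint tight at the first one
    only. *)
Lemma vertex_sep v w : vertex v -> vertex w -> v != w ->
  exists e, [/\ e \in H, v e = 0 & 0 < w e].
Proof.
move=> [[Wv vg v0] vP] [[Ww wg w0] _] neq; apply: boolp.contrapT => none.
case/eqP: neq; rewrite [RHS](vP w) ?wg ?scale1r // => e eH ve.
apply/eqP; rewrite eq_le w0 // andbT leNgt; apply/negP=> we; apply: none.
by exists e.
Qed.

Let D := deletion N [set f].
Let gf : g != f. Proof. by rewrite eq_sym obj_neq. Qed.

Lemma constraint_neq_f e : e \in H -> e != f.
Proof. by case/constraint_neq. Qed.

Lemma offsign_H x e : e \in H -> 0 <= x e ->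
  offsign x e = if x e == 0 then Zero else Pos.
Proof.
move=> /constraint_neq_f ef x0; rewrite offsignE //; case: ifPn => [/eqP->|xn].
  by rewrite /sign_of eqxx.
by apply/eqP; rewrite sign_of_pos lt_def xn.
Qed.

Lemma offsign_g x : x g = 1 -> offsign x g = Pos.
Proof. by move=> xg; rewrite offsignE // xg; apply/eqP;
  rewrite sign_of_pos ltr01. Qed.

Lemma notin_f e : e \notin ground N -> e != f.
Proof. by apply: contraNneq => ->; case: proper => -[]. Qed.

Lemma offsign_out x e : W x -> e \notin ground N -> offsign x e = Zero.
Proof.
by move=> Wx eG; apply/eqP; rewrite offsign_eq0 ?notin_f // (out_ground Wx)
  ?eqxx.
Qed.

Lemma height_ge X (C : {set svec T}) : C \subset covectors D ->
  (forall Y, Y \in C -> sle Y X) ->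
  (forall Y Z, Y \in C -> Z \in C -> sle Y Z || sle Z Y) ->
    (#|C|.-1 <= height D X)%N.
Proof.
move=> CD CX CC.
apply: (@leq_bigmax_cond _ _ (fun C : {set svec T} => #|C|.-1) C).
apply/and3P; split=> //; first exact/forall_inP.
by apply/forall_inP=> Y YC; apply/forall_inP=> Z ZC; apply: CC.
Qed.

Lemma sle_refl X : sle X X. Proof. by apply/forallP=> e; rewrite eqxx orbT. Qed.

Lemma sle0 X : sle (szero T) X.
Proof. by apply/forallP=> e; rewrite ffunE eqxx. Qed.

Lemma sle_comp X Y : sle X (scomp X Y).
Proof. by apply/forallP=> e; rewrite ffunE; case: ifP => //=; rewrite eqxx. Qed.

Lemma scompE X Y e : scomp X Y e = if X e == Zero then Y e else X e.
Proof. by rewrite ffunE. Qed.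

(** Suppose [F] of height 2 lies above two vertices.  No covector lies strictly
    between [offsign v] and [F], so [F] is the composition of the two vertices.
    If they did not span the space of [F], moving [w] along a third direction,
    within the constraints tight at [v], would produce such a covector. *)
Lemma edge_adjacent v w : vertex v -> vertex w ->
  program_edge N g f (offsign v) (offsign w) -> v != w /\ adjacent v w.
Proof.
move=> vv vw /and4P[_ _ neq /exists_inP[F FD /and3P[/eqP hF vF wF]]].
have {}neq : v != w by apply: contraNneq neq => ->.
split=> //; have [e0 [e0H ve0 we0]] := vertex_sep vv vw neq.
have [[Wv vg v0] vP] := vv; have [[Ww wg w0] _] := vw.
have between X : X \in covectors D -> sle (offsign v) X -> sle X F ->
    X != offsign v -> X = F.
  move=> XD vX XF nXv; apply: boolp.contrapT => /eqP nXF.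
  have := @height_ge F [set szero T; offsign v; X; F].
  have v_n0 : offsign v != szero T.
    apply: offsign_neq0 => //; apply: contra_eq_neq vg => ->.
    by rewrite ffunE eq_sym oner_eq0.
  have anti Y : sle Y (szero T) -> Y = szero T.
    by move=> /forallP Y0; apply/ffunP=> e; have := Y0 e;
      rewrite ffunE orbb => /eqP.
  have X_n0 : X != szero T.
    by apply: contraNneq v_n0 => X0; apply/eqP/anti; rewrite -X0.
  have F_n0 : F != szero T.
    by apply: contraNneq v_n0 => F0; apply/eqP/anti; rewrite -F0.
  have F_nv : F != offsign v.
    apply: contra_neq nXF => FE; rewrite FE in XF *; apply/ffunP=> e.
    move: vX XF => /forallP/(_ e) + /forallP/(_ e).
    by case/orP=> /eqP H1; case/orP=> /eqP H2; rewrite ?H1 ?H2.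
  rewrite hF => Hc; suff: (4 <= #|[set szero T; offsign v; X; F]|)%N.
    have /Hc : [set szero T; offsign v; X; F] \subset covectors D.
      apply/subsetP=> Y; rewrite !inE => /orP[/orP[/orP[]|]|] /eqP-> //.
        exact: covector0.
      exact: offsign_covector.
    case: #|_| => // n Hn; rewrite ltnS => n3.
    have : (n <= 2)%N; last by rewrite leqNgt n3.
    apply: Hn => [Y|Y Z].
      rewrite !inE => /orP[/orP[/orP[]|]|] /eqP-> //;
        [exact: sle0|exact: sle_refl].
    by rewrite !inE => /orP[/orP[/orP[]|]|] /eqP-> /orP[/orP[/orP[]|]|] /eqP->;
      rewrite ?sle0 ?sle_refl ?vX ?XF ?vF ?orbT.
  rewrite -!setUA !cardsU1 cards1 !inE ![szero T == _]eq_sym (eq_sym _ X).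
  rewrite (eq_sym (offsign v) F) (negPf v_n0) (negPf X_n0) (negPf F_n0).
  by rewrite (negPf nXv) (negPf F_nv) (negPf nXF).
have compE : scomp (offsign v) (offsign w) = F.
  apply: between.
  - by apply: covector_comp; apply: offsign_covector.
  - exact: sle_comp.
  - apply/forallP=> e; rewrite scompE; case: ifP => _;
      [exact: (forallP wF)|exact: (forallP vF)].
  apply/eqP=> /ffunP/(_ e0); rewrite scompE !offsign_H ?v0 ?w0 //.
  by rewrite ve0 !eqxx gt_eqF.
move=> u Wu uP; apply: boolp.contrapT => nlin.
(* Subtract from [u] the combination of [v] and [w] that agrees with it at [g]
   and at [e0]. *)
pose b := u e0 / w e0; pose a := u g - b.
pose u1 := u + (- a) *: v + (- b) *: w.
have Wu1 : W u1 by apply: subspace_comb => //; apply: subspace_comb.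
have u1g : u1 g = 0.
  by rewrite !ffunE vg wg -![_ *: _]/(_ * _ : R) /a; ring.
have u1e0 : u1 e0 = 0.
  rewrite !ffunE ve0 -![_ *: _]/(_ * _ : R) mulr0 addr0 mulNr.
  by rewrite divfK ?subrr // gt_eqF.
have u1P e : e \in H -> v e = 0 -> w e = 0 -> u1 e = 0.
  by move=> eH ve we; rewrite !ffunE (uP e eH ve we) ve we !scaler0 !addr0.
have u1n0 : u1 != 0.
  apply/eqP=> u10; case: nlin; exists a, b; apply/eqP.
  by rewrite -subr_eq0 -u10 /u1 !scaleNr opprD addrA.
clearbody u1; clear a b u nlin Wu uP.
have [e2 [e2H ve2 ue2]] : exists e, [/\ e \in H, v e = 0 & u1 e != 0].
  apply: boolp.contrapT => none; case/eqP: u1n0.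
  rewrite (vP u1) ?u1g ?scale0r // => e eH ve.
  by apply: boolp.contrapT => /eqP ue; apply: none; exists e.
wlog {ue2} ue2 : u1 Wu1 u1g u1e0 u1P u1n0 / u1 e2 < 0.
  move=> Hw; move: ue2; rewrite neq_lt => /orP[|ue2]; first exact: Hw.
  apply: (Hw (- u1)).
  - exact: subspaceN Wlin _ Wu1.
  - by rewrite ffunE u1g oppr0.
  - by rewrite ffunE u1e0 oppr0.
  - by move=> e eH ve we; rewrite ffunE u1P ?oppr0.
  - by rewrite oppr_eq0.
  by rewrite ffunE oppr_lt0.
have [e|e|t [t0 yt hit]] := @ratio_test R T [set e in H | v e == 0] w u1.
- by rewrite inE => /andP[/w0].
- by rewrite inE => /andP[eH /eqP ve] we; rewrite u1P.
have [|e3 [e3D ue3 ye3]] := hit; first by exists e2 => //;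
  rewrite inE e2H ve2 eqxx.
have {e3D} [e3H ve3] : e3 \in H /\ v e3 = 0.
  by move: e3D; rewrite inE => /andP[? /eqP].
have we3 : w e3 != 0 by apply: contraTneq ue3 => we; rewrite u1P ?ltxx.
set y := w + t *: u1 in yt ye3.
have Wy : W y by apply: subspace_comb.
have ye0 : y e0 = w e0 by rewrite !ffunE u1e0 scaler0 addr0.
have y_w e : e \in H -> v e = 0 -> w e = 0 -> y e = 0.
  by move=> eH ve we; rewrite !ffunE (u1P e eH ve we) we scaler0 addr0.
clearbody y.
suff: scomp (offsign v) (offsign y) = F.
  move/ffunP/(_ e3); rewrite -compE !scompE !offsign_H ?v0 ?w0 ?ye3 ?lexx //.
  by rewrite ve3 !eqxx (negPf we3).
apply: between.
- by apply: covector_comp; apply: offsign_covector.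
- exact: sle_comp.
- apply/forallP=> e; rewrite -compE !scompE.
  case: ifPn => [|_]; last by rewrite eqxx orbT.
  have [->|->|eH|eG] := ground_cases e.
  + by rewrite offsign_g // => /eqP.
  + by rewrite !offsign_f.
  + rewrite offsign_eq0 ?constraint_neq_f // => /eqP ve.
    have y0 : 0 <= y e by apply: yt; rewrite inE eH ve eqxx.
    rewrite !offsign_H ?w0 //; case: (eqVneq (y e) 0) => //= ye.
    by case: (eqVneq (w e) 0) => // we; rewrite y_w ?eqxx in ye.
  + by rewrite !offsign_out.
apply/eqP=> /ffunP/(_ e0); rewrite scompE !offsign_H ?ye0 ?v0 ?w0 //.
by rewrite ve0 !eqxx gt_eqF.
Qed.

(** The faces of an edge are the empty face, its ends and the edge itself. *)
Lemma adjacent_faces v w y : vertex v -> vertex w -> v != w -> adjacent v w ->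
  W y -> sle (offsign y) (scomp (offsign v) (offsign w)) ->
  [\/ offsign y = szero T, offsign y = offsign v, offsign y = offsign w |
      offsign y = scomp (offsign v) (offsign w)].
Proof.
move=> vv vw neq adj Wy yF.
have [e0 [e0H ve0 we0]] := vertex_sep vv vw neq.
have [|e1 [e1H we1 ve1]] := vertex_sep vw vv; first by rewrite eq_sym.
have [[[Wv vg v0] _] [[Ww wg w0] _]] := (vv, vw).
have [|a [b yE]] := adj y Wy.
  move=> e eH ve we; apply: (sle_offsign yF); first exact: constraint_neq_f.
  by rewrite scompE !offsign_H ?v0 ?w0 // ve we eqxx.
have coef c z e : e \in H -> 0 < z e -> y e = c * z e ->
    scomp (offsign v) (offsign w) e = Pos -> 0 <= c.
  move=> eH ze ye Fe; have /forallP/(_ e) := yF.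
  rewrite Fe offsign_eq0 ?constraint_neq_f // offsignE ?constraint_neq_f //
    sign_of_pos ye.
  by rewrite mulf_eq0 (gt_eqF ze) orbF pmulr_lgt0 // le_eqVlt eq_sym.
have b0 : 0 <= b.
  apply: (coef b w e0) => //.
    by rewrite yE !ffunE ve0 scaler0 add0r.
  by rewrite scompE !offsign_H ?v0 ?w0 // ve0 eqxx (gt_eqF we0).
have a0 : 0 <= a.
  apply: (coef a v e1) => //.
    by rewrite yE !ffunE we1 scaler0 addr0.
  by rewrite scompE !offsign_H ?v0 ?w0 // (gt_eqF ve1).
move: a0 b0; rewrite !le_eqVlt !(eq_sym 0).
case/orP=> [/eqP az|a0] /orP[/eqP bz|b0].
- constructor 1; apply/ffunP=> e.
  by rewrite yE az bz !scale0r addr0 !ffunE /sign_of eqxx if_same.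
- by constructor 3; rewrite yE az scale0r add0r offsign_scale.
- by constructor 2; rewrite yE bz scale0r addr0 offsign_scale.
constructor 4; apply/ffunP=> e; rewrite scompE.
have yeE : y e = a * v e + b * w e by rewrite yE !ffunE.
have [->|->|eH|eG] := ground_cases e.
- rewrite (offsign_g vg) /= offsignE // yE !ffunE vg wg -![_ *: _]/(_ * _ :
    R) !mulr1.
  by apply/eqP; rewrite sign_of_pos addr_gt0.
- by rewrite !offsign_f.
- have [ve we] := (v0 e eH, w0 e eH).
  have ye : 0 <= y e by rewrite yeE addr_ge0 // mulr_ge0 // ltW.
  rewrite !offsign_H // yeE paddr_eq0 ?mulr_ge0 ?(ltW a0) ?(ltW b0) //.
  by rewrite !mulf_eq0 (gt_eqF a0) (gt_eqF b0) /=; case: (v e == 0) => //=.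
- by rewrite !offsign_out.
Qed.

Lemma adjacent_edge v w : vertex v -> vertex w -> v != w -> adjacent v w ->
  program_edge N g f (offsign v) (offsign w).
Proof.
move=> vv vw neq adj.
have [vA wA] := (vertex_feasible vv, vertex_feasible vw).
have [[[Wv vg v0] vP] [[Ww wg w0] wP]] := (vv, vw).
have [e0 [e0H ve0 we0]] := vertex_sep vv vw neq.
have [|e1 [e1H we1 ve1]] := vertex_sep vw vv; first by rewrite eq_sym.
set F := scomp (offsign v) (offsign w).
have FD : F \in covectors D by apply: covector_comp; apply: offsign_covector.
have vF : sle (offsign v) F by exact: sle_comp.
have wF : sle (offsign w) F.
  apply/forallP=> e; rewrite scompE; have [->|->|eH|eG] := ground_cases e.
  - by rewrite !offsign_g // orbT.
  - by rewrite !offsign_f.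
  - rewrite !offsign_H ?v0 ?w0 //.
    by case: (w e == 0); case: (v e == 0).
  - by rewrite !offsign_out.
have neqs : offsign v != offsign w.
  by apply: contraNneq neq => /(vertex_offsign_inj vv vw)->.
have ve0' : offsign v e0 = Zero by rewrite offsign_H ?v0 // ve0 eqxx.
have we0' : offsign w e0 = Pos by rewrite offsign_H ?w0 // gt_eqF.
have we1' : offsign w e1 = Zero by rewrite offsign_H ?w0 // we1 eqxx.
have ve1' : offsign v e1 = Pos by rewrite offsign_H ?v0 // gt_eqF.
have Fe0 : F e0 = Pos by rewrite scompE ve0'.
have v_n0 : offsign v != szero T.
  by apply/eqP=> /ffunP/(_ e1); rewrite ve1' ffunE.
have F_n0 : F != szero T by apply/eqP=> /ffunP/(_ e0); rewrite Fe0 ffunE.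
have F_nv : F != offsign v by apply/eqP=> /ffunP/(_ e0); rewrite Fe0 ve0'.
apply/and4P; split=> //.
- by move: vA; rewrite inE => /andP[].
- by move: wA; rewrite inE => /andP[].
apply/exists_inP; exists F => //; rewrite vF wF !andbT eqn_leq; apply/andP;
  split.
  apply/bigmax_leqP=> C /and3P[/subsetP CD /forall_inP CF /forall_inP CC].
  have CP Y : Y \in C -> [\/ Y = szero T, Y = offsign v, Y = offsign w | Y = F].
    move=> YC; have /deletion_covectorP[y Wy YE] := CD Y YC; rewrite YE.
    by apply: adjacent_faces => //; rewrite -YE CF.
  have incomp : ~~ ((offsign v \in C) && (offsign w \in C)).
    apply/negP=> /andP[vC wC]; have /forall_inP/(_ _ wC)/orP[] := CC _ vC.
      by move/forallP/(_ e1); rewrite ve1' we1'.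
    by move/forallP/(_ e0); rewrite ve0' we0'.
  have card3 (a b c : svec T) : C \subset [set a; b; c] -> (#|C|.-1 <= 2)%N.
    move/subset_leq_card => c3; have : (#|C| <= 3)%N.
      apply: leq_trans c3 _; rewrite -setUA !cardsU1 cards1.
      by case: (_ \notin _); case: (_ \notin _).
    by case: #|C|.
  have [vC|vC] := boolP (offsign v \in C).
    have wC : offsign w \notin C by move: incomp; rewrite vC.
    apply: (card3 (szero T) (offsign v) F); apply/subsetP=> Y YC.
    by case: (CP Y YC) (YC) => -> YC'; rewrite ?YC' in wC *;
      rewrite // !inE ?eqxx ?orbT.
  apply: (card3 (szero T) (offsign w) F); apply/subsetP=> Y YC.
  by case: (CP Y YC) (YC) => -> YC'; rewrite ?YC' in vC *;
    rewrite // !inE ?eqxx ?orbT.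
apply: leq_trans (_ : (#|[set szero T; offsign v; F]|.-1 <= _)%N).
  rewrite -!setUA !cardsU1 cards1 !inE ![szero T == _]eq_sym.
  by rewrite (eq_sym (offsign v) F) (negPf v_n0) (negPf F_n0) (negPf F_nv).
apply: height_ge => [|Y|Y Z].
- apply/subsetP=> Y; rewrite !inE => /orP[/orP[]|] /eqP-> //.
    exact: covector0.
  exact: offsign_covector.
- rewrite !inE => /orP[/orP[]|] /eqP-> //; [exact: sle0|exact: sle_refl].
by rewrite !inE => /orP[/orP[]|] /eqP-> /orP[/orP[]|] /eqP->;
  rewrite ?sle0 ?sle_refl ?vF ?orbT.
Qed.

(** A direction at height 0 in the plane of an edge is parallel to the edge. *)
Lemma adjacent_dir v w y : vertex v -> vertex w -> adjacent v w ->
  W y -> y g = 0 -> (forall e, e \in H -> v e = 0 -> w e = 0 -> y e = 0) ->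
  exists b : R, y = b *: (w - v).
Proof.
move=> [[_ vg _] _] [[_ wg _] _] adj Wy yg yP.
have [a [b yE]] := adj y Wy yP; exists b.
have ab : a + b = 0.
  by move: yg; rewrite yE !ffunE vg wg -![_ *: _]/(_ * _ : R) !mulr1.
by rewrite yE scalerBr addrC (_ : a = - b) ?scaleNr //; apply/eqP;
  rewrite -addr_eq0 ab.
Qed.

Lemma pos_multiple (z y : {ffun T -> R^o}) (b : R) e : y = b *: z -> z e != 0 ->
  (sign_of (y e) == Zero) || (sign_of (y e) == sign_of (z e)) -> 0 <= b.
Proof.
move=> -> ze; rewrite ffunE -[_ *: _]/(_ * _ :
  R) sign_of_eq0 mulf_eq0 (negPf ze) orbF.
case/orP=> [/eqP->//|/eqP]; move: ze; rewrite neq_lt => /orP[zn|zp] bz.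
  have /eqP : sign_of (z e) = Neg by apply/eqP; rewrite sign_of_neg.
  by rewrite -bz sign_of_neg nmulr_llt0 // => /ltW.
have /eqP : sign_of (z e) = Pos by apply/eqP; rewrite sign_of_pos.
by rewrite -bz sign_of_pos pmulr_lgt0 // => /ltW.
Qed.

(** The cocircuit that eliminates [g] between the ends [v] and [w] of an edge
    is the sign vector of [w - v]. *)
Lemma edge_signP v w a : vertex v -> vertex w -> v != w -> adjacent v w ->
  edge_sign N g f (offsign v) (offsign w) a = (a == sign_of (w f - v f : R)).
Proof.
move=> vv vw neq adj.
have [[[Wv vg v0] vP] [[Ww wg w0] wP]] := (vv, vw).
have [e0 [e0H ve0 we0]] := vertex_sep vv vw neq.
pose z := w - v.
have Wz : W z by rewrite /z -scaleN1r; apply: subspace_comb.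
have zg : z g = 0 by rewrite !ffunE vg wg subrr.
have zn0 : z != 0 by rewrite subr_eq0 eq_sym.
have zf : z f = w f - v f by rewrite !ffunE.
have zE e : z e = w e - v e by rewrite !ffunE.
have dir y : W y -> y g = 0 ->
    (forall e, e \in H -> v e = 0 -> w e = 0 -> y e = 0) ->
    exists b : R, y = b *: z by exact: adjacent_dir.
clearbody z.
rewrite -zf; apply/existsP/eqP => [[Z]|aE].
  case/andP=> /and4P[ZD /eqP Zg /forallP Zp /forallP Zn] /and3P[+ Zn0 _].
  case/WP=> y Wy ZE.
  have yE e : e != f -> sign_of (y e) = Z e.
    by move=> ef; have /ffunP/(_ e) := ZE; rewrite !ffunE (negPf ef) => ->.
  have yf : a = sign_of (y f) by have /ffunP/(_ f) := ZE; rewrite !ffunE eqxx.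
  have yg : y g = 0 by apply/eqP; rewrite -sign_of_eq0 yE // Zg.
  have [|b ybz] := dir y Wy yg.
    move=> e eH ve we; apply/eqP; rewrite -sign_of_eq0 yE ?constraint_neq_f //.
    have := Zp e; have := Zn e; rewrite !offsign_H ?v0 ?w0 // ve we eqxx.
    by case: (Z e).
  have b0 : b != 0.
    apply: contraNneq Zn0 => bz; apply/eqP/ffunP=> e.
    by rewrite ZE ybz bz scale0r !ffunE /sign_of eqxx.
  have bp : 0 < b.
    rewrite lt_def b0; apply: (@pos_multiple z y b e0) => //.
      by rewrite zE ve0 subr0 gt_eqF.
    have := Zn e0; rewrite !offsign_H ?v0 ?w0 // ve0 eqxx (gt_eqF we0) /=.
    have -> : sign_of (z e0) = Pos by apply/eqP;
      rewrite sign_of_pos zE ve0 subr0.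
    by rewrite yE ?constraint_neq_f //; case: (Z e0).
  by rewrite yf ybz ffunE -[_ *: _]/(_ * _ : R) sign_ofM.
exists (offsign z); apply/andP; split.
  apply/and4P; split.
  - apply/and3P; split; [exact: offsign_covector|exact: offsign_neq0|].
    apply/forall_inP=> _ /deletion_covectorP[y Wy ->];
      apply/implyP=> /andP[y0 yz].
    have [||b ybz] := dir y Wy.
    + by apply: (sle_offsign yz gf); apply/eqP; rewrite offsign_eq0 // zg.
    + move=> e eH ve we; apply: (sle_offsign yz (constraint_neq_f eH)).
      by apply/eqP; rewrite offsign_eq0 ?constraint_neq_f // zE ve we subrr.
    have b0 : b != 0 by apply: contraNneq (offsign_szero y0) => bz;
      rewrite ybz bz scale0r.
    have bp : 0 < b.
      rewrite lt_def b0; apply: (@pos_multiple z y b e0) => //.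
        by rewrite zE ve0 subr0 gt_eqF.
      by have /forallP/(_ e0) := yz; rewrite !offsignE ?constraint_neq_f.
    by rewrite ybz offsign_scale.
  - by rewrite offsign_eq0 // zg.
  - apply/forallP=> e; have [->|->|eH|eG] := ground_cases e.
    + by rewrite offsignE // zg /sign_of eqxx.
    + by rewrite offsign_f.
    + rewrite offsignE ?constraint_neq_f // sign_of_pos zE subr_gt0;
        apply/implyP=> lt_vw.
      by rewrite orbC offsignE ?constraint_neq_f // sign_of_pos (le_lt_trans
        (v0 e eH)).
    + by rewrite offsign_out.
  - apply/forallP=> e; have [->|->|eH|eG] := ground_cases e.
    + by rewrite offsignE // zg /sign_of eqxx.
    + by rewrite offsign_f.
    + rewrite offsignE ?constraint_neq_f // sign_of_neg zE subr_lt0;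
        apply/implyP=> lt_vw.
      by rewrite offsignE ?constraint_neq_f // sign_of_pos (le_lt_trans (w0 e
        eH)).
    + by rewrite offsign_out.
have -> : extend f (offsign z) a = sign_vector z.
  apply/ffunP=> e; rewrite !ffunE inE; case: eqP => [->|//].
  by rewrite aE.
apply/and3P; split; [exact: sign_vectorP|exact: sign_vector_neq0|].
apply/forall_inP=> Y /WP[y Wy ->]; apply/implyP=> /andP[y0 /forallP yz].
have supp e : z e = 0 -> y e = 0.
  move=> ze; have := yz e; rewrite !ffunE.
  have /eqP-> : sign_of (z e) == Zero by rewrite sign_of_eq0 ze.
  by rewrite orbb sign_of_eq0 => /eqP.
have [||b ybz] := dir y Wy; first exact: supp.
  by move=> e eH ve we; apply: supp; rewrite zE ve we subrr.
have b0 : b != 0.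
  apply: contraNneq y0 => bz; apply/eqP/ffunP=> e.
  by rewrite ybz bz scale0r !ffunE /sign_of eqxx.
have bp : 0 < b.
  rewrite lt_def b0; apply: (@pos_multiple z y b e0) => //.
    by rewrite zE ve0 subr0 gt_eqF.
  by have := yz e0; rewrite !ffunE.
apply/eqP/ffunP=> e; rewrite ybz !ffunE -[_ *: _]/(_ * _ : R) sign_ofM //.
Qed.

Lemma generic_edge v w : vertex v -> vertex w -> adjacent v w ->
  v f = w f -> v = w.
Proof.
move=> vv vw adj vwf; apply: boolp.contrapT => /eqP neq.
have [_ _ _ gen] := proper.
have /negP[] := gen _ _ (vertex_feasible vv) (vertex_feasible vw).
rewrite /nonoriented_edge adjacent_edge //= edge_signP //.
by rewrite vwf subrr /sign_of eqxx.
Qed.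

Lemma program_arcP v w : vertex v -> vertex w ->
  program_arc N g f (offsign v) (offsign w) <-> adjacent v w /\ (v f : R) < w f.
Proof.
move=> vv vw; split=> [/andP[/(edge_adjacent vv vw)[neq adj]]|[adj lt_vw]].
  by rewrite edge_signP // eq_sym sign_of_pos subr_gt0.
have neq : v != w by apply: contraTneq lt_vw => ->; rewrite ltxx.
by rewrite /program_arc adjacent_edge //= edge_signP // eq_sym sign_of_pos
  subr_gt0.
Qed.

(** Let [B] be independent with [om_rank N] elements. The combinations of the
    coordinates in [B] that vanish on [xs] form a nonzero space, and each
    nonzero combination is nonzero on [W]: a covector that vanishes on [B]
    except at one element with nonzero coefficient shows this. *)
Lemma vanishing_functional (xs : seq {ffun T -> R^o}) :
  (size xs < om_rank N)%N ->
  exists l : {ffun T -> R^o} -> R, [/\ scalar l, forall x, x \in xs -> l x = 0 &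
    exists2 w, W w & l w != 0].
Proof.
have [B B_indep rk] : exists2 B : {set T}, om_indep N B & om_rank N = #|B|.
  have : (0 < #|om_indep N|)%N.
    apply/card_gt0P; exists set0; rewrite unfold_in /om_indep sub0set /=.
    by apply/forall_inP=> e; rewrite inE.
  by case/(eq_bigmax_cond (fun B : {set T} => #|B|)) => B BI BE; exists B.
rewrite {}rk => ltk.
pose Mx : 'M[R]_(#|B|, size xs) := \matrix_(i, j) (nth 0 xs j (enum_val i)).
have /rowV0Pn[c /sub_kermxP cM c0] : kermx Mx != 0.
  rewrite kermx_eq0 /row_free; apply: contraL ltk => /eqP <-.
  by rewrite -leqNgt rank_leq_col.
exists (fun x => \sum_(i < #|B|) c ord0 i * x (enum_val i)); split.
- move=> a u v; rewrite mulr_sumr -big_split; apply: eq_bigr => i _ /=.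
  by rewrite !ffunE -[_ *: _]/(_ * _ : R); ring.
- move=> x /(nthP 0)[j ltj <-].
  move/rowP/(_ (Ordinal ltj)): cM; rewrite !mxE => {2}<-.
  by apply: eq_bigr => i _; rewrite !mxE.
have /rV0Pn[i ci] := c0.
have [BG /forall_inP/(_ _ (enum_valP i))] := andP B_indep.
rewrite inE (subsetP BG) ?enum_valP //= => /forall_inPn[_ /WP[w Ww ->]].
rewrite negb_imply => /andP[/forall_inP wB]; rewrite ffunE sign_of_eq0 => wi.
exists w => //; rewrite (bigD1 i) //= big1 ?addr0 ?mulf_neq0 // => j neq_ji.
have := wB (enum_val j); rewrite !inE (inj_eq enum_val_inj) neq_ji enum_valP.
by rewrite ffunE sign_of_eq0 => /(_ isT)/eqP->; rewrite mulr0.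
Qed.

(** Since the polytope has an interior point, a linear form that is nonzero on
    [W] is nonzero on the polytope. *)
Lemma vanishing_polytope (xs : seq {ffun T -> R^o}) :
  (size xs < om_rank N)%N ->
  exists l : {ffun T -> R^o} -> R, [/\ scalar l, forall x, x \in xs -> l x = 0 &
    exists2 x, polytope x & l x != 0].
Proof.
case/vanishing_functional=> l [hl lxs [w Ww lw]]; exists l; split=> //.
have [x xP xH] := interior_point; have [Wx xg x0] := xP.
have [lx|] := eqVneq (l x) 0; last by exists x.
pose y := w + (- w g) *: x.
have yg : y g = 0 by rewrite !ffunE xg -[_ *: _]/(_ * _ : R) mulr1 subrr.
have Wy : W y by apply: subspace_comb.
have ly : l y != 0 by rewrite scalar_comb // lx mulr0 addr0.
clearbody y; have [e eH xe|t [t0 xt _]] := @ratio_test R T H x y x0.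
  by rewrite (xH e eH xe y Wy).
exists (x + t *: y).
  by split=> //; [apply: subspace_comb|rewrite !ffunE xg yg scaler0 addr0].
by rewrite scalar_comb // lx add0r mulf_neq0 // gt_eqF.
Qed.
End ProperProgram.

(** * The Holt-Klee theorem *)

(** Passes from a list of internally disjoint paths to an indexed family. *)
Lemma nth_paths (I : finType) (A : {set I}) (arc : rel I) (s t : I) d
    (ps : seq (seq I)) :
  (d <= size ps)%N -> uniq ps ->
  (forall p, p \in ps -> directed_path A arc s t p) ->
  (forall p q v, p \in ps -> q \in ps -> p != q ->
    v \in p -> v \in q -> v = t) ->
  exists P : 'I_d -> seq I,
    [/\ injective P, forall i, directed_path A arc s t (P i) &
      forall i j v, i != j -> v \in s :: P i -> v \in s :: P j ->
        v = s \/ v = t].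
Proof.
move=> led Ups psP psD; exists (fun i => nth [::] ps i).
have lt_size (i : 'I_d) : (i < size ps)%N by apply: leq_trans led.
have inj : injective (fun i : 'I_d => nth [::] ps i).
  by move=> i j /eqP; rewrite nth_uniq // => /eqP /val_inj.
split=> // [i|i j v neq]; first by apply/psP/mem_nth.
rewrite !inE => /orP[/eqP->|vi]; first by left.
case/orP=> [/eqP->|vj]; [by left|right].
apply: (psD (nth [::] ps i) (nth [::] ps j)); rewrite ?mem_nth //.
by apply: contra_neq neq => /inj.
Qed.

Section HoltKlee.
Variables (R : realType) (T : finType) (N : orientedMatroid T).
Variables (W : {ffun T -> R^o} -> Prop) (g f : T).
Hypothesis WN : realizes W N.
Hypothesis proper : proper_program N g f.

Let H : {set T} := ground N :\: [set g; f].
Local Notation polytope := (polytope W g H).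
Local Notation vertex := (vertex W g H).
Local Notation adjacent := (adjacent W H).
Let Wlin := WN.1.
Let A := feasible_vertices N g f.
Let arc := program_arc N g f.
Let phi (x : {ffun T -> R^o}) : R := x f.
Let W_bnd := polytope_bounded WN proper.

Theorem realized_HK : HK_program N g f.
Proof.
have hphi : scalar phi by apply: coord_scalar.
have hNphi : scalar (fun x => - phi x) by move=> a u v;
  rewrite hphi mulrN opprD.
(* Each feasible vertex is represented by a point. *)
have [pt ptP] : exists pt : svec T -> {ffun T -> R^o},
    forall V, V \in A -> vertex (pt V) /\ V = offsign f (pt V).
  apply: (@fin_all_exists _ (fun=> {ffun T -> R^o})
    (fun V x => V \in A -> vertex x /\ V = offsign f x)) => V.
  have [/(feasible_vertex WN proper)[v vv VE]|VA] := boolP (V \in A);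
    last by exists 0.
  by exists v.
have ptA V : V \in A -> vertex (pt V) by case/ptP.
have ptE V : V \in A -> offsign f (pt V) = V by case/ptP.
have pt_onto v : vertex v -> exists2 V, V \in A & pt V = v.
  move=> vv; exists (offsign f v); first exact: (vertex_feasible WN proper).
  have vA := vertex_feasible WN proper vv.
  by apply: (vertex_offsign_inj _ vv); [exact: ptA|exact: ptE].
have pt_inj : {in A &, injective pt}.
  by move=> V V' VA V'A eqV; rewrite -(ptE V VA) eqV ptE.
have arcP V V' : V \in A -> V' \in A ->
    arc V V' <-> adjacent (pt V) (pt V') /\ phi (pt V) < phi (pt V').
  move=> VA V'A; rewrite -{1}(ptE V VA) -{1}(ptE V' V'A).
  exact (program_arcP WN proper (ptA V VA) (ptA V' V'A)).
have gen v w : vertex v -> vertex w -> adjacent v w -> phi v = phi w -> v = w.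
  exact: (generic_edge WN proper).
have [x0 x0P _] := interior_point WN proper.
have [v0 /pt_onto[V0 V0A _] _] := vertex_ge Wlin W_bnd hphi x0P.
have optimum psi : scalar psi ->
    (forall v w, vertex v -> vertex w -> adjacent v w -> psi v = psi w ->
      v = w) ->
    exists2 t, t \in A & forall V, V \in A -> V != t -> psi (pt V) < psi (pt t).
  move=> hpsi genpsi.
  case: (@arg_minP _ R _ V0 (mem A) (fun V => - psi (pt V)) V0A) => t tA tmax.
  have {}tmax V : V \in A -> psi (pt V) <= psi (pt t).
    by move=> VA; rewrite -lerN2; apply: tmax.
  exists t => // V VA Vt; rewrite lt_neqAle tmax // andbT;
    apply: contra_neq Vt => eqV.
  apply: pt_inj => //; apply: (unique_max Wlin W_bnd hpsi genpsi (ptA t tA)) =>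
    //.
    by apply: (max_on_vertices Wlin W_bnd pt_onto hpsi) => V' V'A; apply: tmax.
  by case: (ptA V VA).
have [t tA t_max] := optimum phi hphi gen.
have [|s sA s_max] := optimum _ hNphi.
  by move=> v w vv vw adj /oppr_inj; apply: gen.
have s_min V : V \in A -> V != s -> phi (pt s) < phi (pt V).
  by move=> VA /(s_max V VA); rewrite ltrN2.
have improve psi V V' : scalar psi -> V \in A -> V' \in A ->
  psi (pt V) < psi (pt V') ->
    exists X, [/\ X \in A, adjacent (pt V) (pt X) & psi (pt V) < psi (pt X)].
  move=> hpsi VA V'A lt_V.
  have [w [vw aw lt_w]] := improving_edge Wlin W_bnd hpsi (ptA V VA) (ptA V'
    V'A).1 lt_V.
  by have [X XA Xw] := pt_onto w vw; exists X; rewrite Xw.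
have adj_sym v w : adjacent v w -> adjacent w v.
  move=> adj u Wu uP; have [|a [b uE]] := adj u Wu; last by exists b, a;
    rewrite addrC.
  by move=> e eH ve we; apply: uP.
pose e := [rel V V' | boolp.asbool (mono_edge W H A pt phi V V')].
have eP V V' : e V V' -> [/\ V \in A, V' \in A & arc V V'].
  by move=> /boolp.asboolP[VA V'A adj lt_V]; split=> //; apply/arcP.
have dpath p : path e s p -> last s p = t -> uniq (s :: p) ->
  directed_path A arc s t p.
  move=> sp lp Up; apply/and4P; split=> //; last by rewrite lp.
    rewrite /= sA /=; elim: (p) (s) sp => //= V q IHq V1 /andP[/eP[_ -> _]].
    exact: IHq.
  by apply: sub_path sp => V V' /eP[].
have avoid := avoiding_path Wlin W_bnd hphi ptA pt_onto sA tA s_min t_max.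
(* A monotone path avoiding the vertices in [S], obtained from a linear form
   that vanishes on a list [xs] containing [S] and [s], and also [t] if [s ->
   t] is an arc. *)
have separate (S : {set svec T}) (xs : seq (svec T)) : s \in xs ->
    (size xs < om_rank N)%N -> {subset S <= xs} -> t \notin S ->
    (t \in xs) || ~~ e s t ->
    exists p, [/\ path [rel u v | e u v && ((u, v) != (s, t))] s p,
       last s p = t & forall v, v \in p -> v \notin S].
  move=> s_xs lt_xs S_xs tS t_or.
  have [|l [hl lxs lx]] := vanishing_polytope WN proper (xs := map pt xs).
    by rewrite size_map.
  have l0 V : V \in xs -> l (pt V) = 0 by move=> Vx; apply: lxs; apply: map_f.
  have [p [p1 p2 p3 p4]] := avoid l hl (l0 s s_xs) lx; exists p; split=> //.
    have [/l0/p4//|t_xs] := boolP (t \in xs).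
    rewrite (negPf t_xs) /= in t_or.
    apply: sub_path p1 => V V' VV'; rewrite /= [X in X && _]VV' /=.
    by apply: contraNneq t_or => -[<- <-].
  move=> V Vp; apply: contraNN tS => VS.
  by rewrite -(p3 V Vp) // l0 // S_xs.
exists s, t; split.
- move=> V; split=> [/andP[VA /forall_inP noarc]|->]; last first.
    rewrite /is_source sA; apply/forall_inP=> X XA;
      apply/negP=> /(arcP X s XA sA)[_].
    by have [->|/(s_min X XA)/lt_gtF->//] := eqVneq X s; rewrite ltxx.
  apply/eqP/negPn/negP=> Vs.
  have [|X [XA adj]] := improve _ V s hNphi VA sA; first by rewrite ltrN2 s_min.
  rewrite ltrN2 => lt_X; have /negP[] := noarc X XA; apply/arcP => //.
  by split=> //; apply: adj_sym.
- move=> V; split=> [/andP[VA /forall_inP noarc]|->]; last first.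
    rewrite /is_sink tA; apply/forall_inP=> X XA;
      apply/negP=> /(arcP t X tA XA)[_].
    by have [->|/(t_max X XA)/lt_gtF->//] := eqVneq X t; rewrite ltxx.
  apply/eqP/negPn/negP=> Vt.
  have [|X [XA adj lt_X]] := improve _ V t hphi VA tA; first exact: t_max.
  by have /negP[] := noarc X XA; apply/arcP.
have [d0|d_gt0] := posnP (om_rank N).-1.
  by rewrite d0; apply: (@nth_paths _ _ _ _ _ 0 [::]).
have lt_d k : (k <= (om_rank N).-1)%N -> (k < om_rank N)%N.
  by move=> kd; rewrite -(prednK (leq_trans d_gt0 (leq_pred _))).
(* If [s = t] there is only one vertex, and the linear form vanishing there
   would vanish on the whole polytope. *)
have neq_st : s != t.
  apply/eqP=> st.
  have [|l [hl lxs [x xP]]] := vanishing_polytope WN proper (xs := [:: pt s]).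
    exact: lt_d.
  have A_s V : V \in A -> l (pt V) = 0.
    move=> VA; have [->|Vs] := eqVneq V s; first by apply: lxs;
      rewrite mem_head.
    by have := s_min V VA Vs; rewrite st lt_gtF // t_max // -st.
  have hNl : scalar (fun x => - l x) by move=> a u v; rewrite hl mulrN opprD.
  have := max_on_vertices Wlin W_bnd pt_onto (v := pt s) hl _ xP.
  have := max_on_vertices Wlin W_bnd pt_onto (v := pt s) hNl _ xP.
  rewrite A_s // oppr0 oppr_le0 => /(_ _)/wrap[|x1].
    by move=> V VA; rewrite A_s ?oppr0.
  move=> /(_ _)/wrap[|x2]; first by move=> V VA; rewrite A_s.
  by rewrite eq_le x1 x2.
have Esize (S : {set svec T}) : size (enum S) = #|S| by rewrite -cardE.
(* If [s -> t] is an arc, it is one of the paths, and the [d - 1] others are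
   found in the digraph without it. *)
have [est|nest] := boolP (e s t).
  have [|S ltS sS tS|ps [sz Ups psP psD]] :=
    @menger_st _ e s t (om_rank N).-2 => //.
    apply: (separate S [:: s, t & enum S]) => //.
    - exact: mem_head.
    - by apply: lt_d; rewrite /= Esize; move: ltS d_gt0;
        case: (om_rank N) => [|[|n]].
    - by move=> V VS; rewrite !inE mem_enum VS !orbT.
    - by rewrite !inE eqxx orbT.
  have st_ps : [:: t] \notin ps.
    by apply/negP=> /psP[]; rewrite /= eqxx !andbF.
  apply: (@nth_paths _ _ _ _ _ _ ([:: t] :: ps)).
  - by rewrite /= sz; case: (om_rank N).-1.
  - by rewrite /= st_ps.
  - move=> p; rewrite inE => /orP[/eqP->|/psP[sp lp Up]].
      by apply: dpath; rewrite //= ?inE ?neq_st // [X in X && _]est.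
    by apply: dpath => //; apply: sub_path sp => V V' /andP[].
  - move=> p q V; rewrite !inE => /orP[/eqP->|pP] /orP[/eqP->|qP].
    + by rewrite eqxx.
    + by rewrite inE => _ /eqP.
    + by rewrite inE => _ _ /eqP.
    + exact: psD.
have [|S ltS sS tS|ps [sz Ups psP psD]] := @menger_st _ e s t (om_rank N).-1 =>
  //.
  apply: (separate S (s :: enum S)) => //.
  - exact: mem_head.
  - by apply: lt_d; rewrite /= Esize.
  - by move=> V VS; rewrite inE mem_enum VS orbT.
  - by rewrite nest orbT.
apply: (@nth_paths _ _ _ _ _ _ ps) => //; first by rewrite sz.
by move=> p /psP[sp lp Up]; apply: dpath => //;
  apply: sub_path sp => V V' /andP[].
Qed.
End HoltKlee.

Theorem proposition1 (R : realType) (T : finType) (M : orientedMatroid T) :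
  representable R M -> HK M.
Proof.
move=> /realizes_representable[W WM] N MN f g _ _ _ proper.
have [W' W'N] := realizes_obtained WM MN.
exact: realized_HK W'N proper.
Qed.
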